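(* As $d\to\infty$, $$K(d)\geq (1+o(1))\,\frac{\sqrt{3\pi}}{4\sqrt2}\,\log\frac{3}{2}\cdot d^{3/2}\cdot \Big(\frac{2}{\sqrt{3}}\Big)^{d}.$$
   Context: The kissing number $K(d)$ is the maximum number of non-overlapping (i.e. with pairwise disjoint interiors) unit balls in $\mathbb R^d$ that can touch a given unit ball. Logarithms are natural logarithms. *)

(* Defs.v *)
From HB Require Import structures.
From mathcomp Require Import all_boot all_order all_algebra.
From mathcomp Require Import all_classical all_reals all_analysis.
From mathcomp Require Import ring lra.

Set Implicit Arguments.
Unset Strict Implicit.
Unset Printing Implicit Defensive.

Import Order.TTheory GRing.Theory Num.Theory.
Import numFieldNormedType.Exports.

Local Open Scope classical_set_scope.
Local Open Scope ring_scope.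

(* The library norm on 'rV[R]_d is the sup norm, hence this definition. *)
Definition enorm (R : realType) (d : nat) (x : 'rV[R]_d) : R :=
  Num.sqrt (\sum_(i < d) x ord0 i ^+ 2).

Definition unit_ball (R : realType) (d : nat) (c : 'rV[R]_d) : set 'rV[R]_d :=
  [set y | enorm (y - c) <= 1].

(* Interiors are taken in the product topology of 'rV[R]_d, which is the
   Euclidean topology. *)
Definition nonoverlapping (T : topologicalType) (A B : set T) : Prop :=
  interior A `&` interior B = set0.

Definition touch (T : topologicalType) (A B : set T) : Prop :=
  A `&` B !=set0 /\ nonoverlapping A B.

Definition kissing (R : realType) (d n : nat) : Prop :=
  exists (c : 'rV[R]_d) (x : 'I_n -> 'rV[R]_d),
    (forall i, touch (unit_ball (x i)) (unit_ball c)) /\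
    (forall i j, i != j ->
      nonoverlapping (unit_ball (x i)) (unit_ball (x j))).

Definition is_kissing_number (R : realType) (d n : nat) : Prop :=
  kissing R d n /\ forall m, kissing R d m -> (m <= n)%N.

(* [kissing_numberP] below shows that the maximum exists, so that the default
   value 0 of [xget] is never the reason for a value of [kissing_number]. *)
Definition kissing_number (R : realType) (d : nat) : nat :=
  xget 0%N [set n | is_kissing_number R d n].

Lemma unit_ball_coord (R : realType) (d : nat) (c y : 'rV[R]_d) (k : 'I_d) :
  unit_ball c y -> `|y ord0 k - c ord0 k| <= 1.
Proof.
rewrite /unit_ball /enorm /= => h.
rewrite -sqrtr_sqr; apply: le_trans h; rewrite ler_wsqrtr //.
rewrite (bigD1 k) //= !mxE lerDl.
by apply: sumr_ge0 => i _; rewrite sqr_ge0.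
Qed.

Lemma interior_unit_ball (R : realType) (d : nat) (a b : 'rV[R]_d) :
  (forall k, `|a ord0 k - b ord0 k| <= d.+1%:R^-1) ->
  interior (unit_ball b) a.
Proof.
move=> hab; have d0 : 0 < d.+1%:R^-1 :> R by rewrite invr_gt0 ltr0n.
apply/nbhs_ballP; exists d.+1%:R^-1 => //= y [_ hy].
rewrite /unit_ball /enorm /= -[leRHS]sqrtr1 ler_wsqrtr //.
apply: (@le_trans _ _ (\sum_(i < d) (2 * d.+1%:R^-1) ^+ 2 : R)).
  apply: ler_sum => k _; rewrite !mxE -real_normK ?num_real // lerXn2r ?nnegrE //.
  have := hy ord0 k; rewrite /ball /= => h1.
  have := hab k; rewrite distrC in h1.
  have := ler_normD (y ord0 k - a ord0 k) (a ord0 k - b ord0 k).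
  rewrite subrKA; move: h1; move: (d.+1%:R^-1 : R) => e; lra.
rewrite sumr_const card_ord -[leLHS]mulr_natl exprMn exprVn mulrA.
rewrite ler_pdivrMr ?exprn_gt0 ?ltr0n // mul1r -natr1.
have := sqr_ge0 (d%:R - 1 : R); lra.
Qed.

Lemma kissing_bounded (R : realType) (d n : nat) :
  kissing R d n -> (n <= #|{ffun 'I_d -> 'I_(4 * d + 5)}|)%N.
Proof.
case=> c [x [xc xx]].
pose t (i : 'I_n) k : R := (x i ord0 k - c ord0 k + 2) * d.+1%:R.
have d0 : 0 < d.+1%:R :> R by rewrite ltr0n.
have ht i k : 0 <= t i k <= 4 * d.+1%:R.
  case: (xc i) => -[z [z1 z2]] _.
  have := unit_ball_coord k z1; have := unit_ball_coord k z2.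
  rewrite !ler_norml => h1 h2.
  apply/andP; split; first by apply: mulr_ge0; [lra | exact: ltW].
  by rewrite ler_pM2r //; lra.
have hb i k : (Num.truncn (t i k) < 4 * d + 5)%N.
  have /andP[t0 t4] := ht i k.
  rewrite -(ltr_nat R); have /andP[/le_lt_trans -> //] := truncn_itv t0.
  by apply: le_lt_trans t4 _; rewrite -natrM ltr_nat mulnS addnC ltn_add2l.
pose F i := [ffun k => Ordinal (hb i k)].
have Finj : injective F.
  move=> i j Fij; apply/eqP; apply/negPn/negP => ij.
  have := xx _ _ ij; rewrite /nonoverlapping => H.
  suff : set0 (x i) by [].
  rewrite -H; split; apply: interior_unit_ball => k.
    by rewrite subrr normr0 invr_ge0 ltW.
  have /ffunP/(_ k)/(congr1 val) := Fij; rewrite !ffunE /= => e.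
  have /andP[ti0 _] := ht i k; have /andP[tj0 _] := ht j k.
  have := truncn_itv ti0; have := truncn_itv tj0; rewrite -e => h1 h2; rewrite -!natr1 in h1 h2.
  rewrite -[leRHS]mul1r ler_pdivlMr //.
  have -> : `|x i ord0 k - x j ord0 k| * d.+1%:R = `|t i k - t j k|.
    by rewrite -[X in _ * X](gtr0_norm d0) -normrM /t; congr (`|_|); ring.
  by rewrite ler_norml; lra.
by have := leq_card F Finj; rewrite card_ord.
Qed.

Lemma kissing_numberP (R : realType) (d : nat) :
  is_kissing_number R d (kissing_number R d).
Proof.
apply: (@xgetPex _ 0%N [set n | is_kissing_number R d n]).
have k0 : exists n, `[< kissing R d n >].
  by exists 0%N; apply/asboolP; exists 0, (fun=> 0); split=> [[]|[]].
have kb n : `[< kissing R d n >] -> (n <= #|{ffun 'I_d -> 'I_(4 * d + 5)}|)%N.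
  by move=> /asboolP; exact: kissing_bounded.
case: (ex_maxnP k0 kb) => n /asboolP kn nmax.
by exists n; split=> // m /asboolP; exact: nmax.
Qed.

(* Main.v *)
(* Proof idea. Take a fine finite weighted system of points on the unit sphere of R^d and
   join two points at angle at most 60 degrees; an independent set of this graph is a
   kissing configuration. Draw an independent set from the hard-core model of activity
   l. Conditionally on the part of the set outside the closed neighbourhood of a point v,
   the rest is a hard-core set on the uncovered part T of the neighbourhood, with
   partition function Z_T. The point v is occupied with probability proportional to
   l / Z_T, while the expected number of points near v is at least log Z_T, up to lower
   order terms, as soon as T spans few edges. Either way the mean size of the set is at
   least (log (l s) - o(d)) / s, where s is the measure of a cap of radius 60 degrees.

   Sets of measure at least e^(o(d)) times that of a 45 degree cap span few edges: if a
   random pair of points of T is close with probability p, then k random points have a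
   common neighbour with probability at least p^k, which makes either their sum
   unusually long or the neighbour lie in a 45 degree cap. Hence l can be taken as large
   as 2^(d/2), up to e^(o(d)), and l s is then about (3/2)^(d/2).

   The point systems are products of samples of spherical coordinates: by induction on
   the dimension their moments in every direction approach those of the sphere, and
   Bernstein polynomials pass from moments to Lipschitz functions. *)

Require Import Defs.
From HB Require Import structures.
From mathcomp Require Import all_boot all_order all_algebra.
From mathcomp Require Import all_classical all_reals all_analysis.
From mathcomp Require Import ring lra zify.

Set Implicit Arguments.
Unset Strict Implicit.
Unset Printing Implicit Defensive.

Import Order.TTheory GRing.Theory Num.Theory.
Import numFieldNormedType.Exports.

Local Open Scope classical_set_scope.
Local Open Scope ring_scope.

(** * The hard-core model *)

(** The angle of 45 degrees arises as follows. A point within 60 degrees of [k] unit vectors has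
    inner product at least [k / 2] with their sum; if the sum is no longer than [k / sqrt 2], its
    direction makes a cosine of at least [1 / sqrt 2] with the point. Longer sums are rare by a
    Chernoff bound with the same tilt [sqrt 2 * d].

    The argument runs on a finite set, yet three inputs must hold around every direction, including
    those of sums of points: an upper bound for 60 degree caps, an exponential moment, and a lower
    bound for small caps. Moments are convenient because they are polynomial in the direction, so
    one finite system controls all directions at once. Its number of points never enters the final
    bound, hence no rate of approximation is required. Only the 60 degree cap has to be sharp up to
    [1 + o(1)]; the other two inputs may lose factors that are later absorbed into [e^(o(d))]. The
    constant is then [d / 2 * log (3 / 2)] divided by [2 (sqrt 3 / 2)^(d-1) / sqrt (2 pi d)]. *)

Section HardCore.
Import mathcomp.boot.fintype mathcomp.boot.finset.
Local Close Scope classical_set_scope.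
Variables (R : realType) (V : finType) (adj : rel V) (w : V -> R).
Hypotheses (adjxx : reflexive adj) (adjC : symmetric adj).
Hypothesis w_ge0 : forall v, 0 <= w v.

Implicit Types (A B I J N T : {set V}) (x y v : V) (l : R).

Definition indep A := [forall x in A, forall y in A, adj x y ==> (x == y)].
Definition nb x := [set y | adj x y].
Definition wt T := \sum_(x in T) w x.
(* [hcw] and [hcZ] are the weight and the partition function at activity l, and
   [hcS l T g] is [hcZ l T] times the mean of the sum of g over the random set. *)
Definition hcw l A := \prod_(x in A) (l * w x).
Definition hcZ l T := \sum_(A : {set V} | (A \subset T) && indep A) hcw l A.
Definition hcS l T (g : V -> R) :=
  \sum_(A : {set V} | (A \subset T) && indep A) hcw l A * \sum_(x in A) g x.

Lemma indepP A :
  reflect (forall x y, x \in A -> y \in A -> adj x y -> x = y) (indep A).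
Proof.
apply: (iffP forall_inP) => [h x y xA yA xy|h x xA].
  by have /forall_inP/(_ _ yA)/implyP/(_ xy)/eqP := h _ xA.
by apply/forall_inP => y yA; apply/implyP => xy; apply/eqP; exact: h.
Qed.

Lemma indepS A B : A \subset B -> indep B -> indep A.
Proof.
move=> /subsetP AB /indepP h; apply/indepP => x y xA yA.
by apply: h; exact: AB.
Qed.

Lemma indepU A B : [disjoint A & B] ->
  indep (A :|: B) = [&& indep A, indep B & [forall x in A, [disjoint B & nb x]]].
Proof.
move=> dAB; apply/idP/idP => [h|/and3P[/indepP hA /indepP hB /forall_inP hAB]].
  rewrite (indepS (subsetUl _ _) h) (indepS (subsetUr _ _) h) /=.
  apply/forall_inP => x xA; rewrite disjoint_subset; apply/subsetP => y yB.
  rewrite !inE; apply/negP => xy; move/indepP : h => /(_ x y).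
  rewrite !inE xA yB orbT => /(_ isT isT xy) exy.
  by move: dAB => /pred0P/(_ x); rewrite /= xA exy yB.
have key x y : x \in A -> y \in B -> adj x y -> False.
  move=> xA yB xy; move: (hAB _ xA); rewrite disjoint_subset => /subsetP/(_ _ yB).
  by rewrite !inE xy.
apply/indepP => x y; rewrite !inE => /orP[xA|xB] /orP[yA|yB] xy.
- exact: hA.
- by case: (key _ _ xA yB xy).
- by rewrite adjC in xy; case: (key _ _ yA xB xy).
- exact: hB.
Qed.

Lemma hcw_ge0 l A : 0 <= l -> 0 <= hcw l A.
Proof. by move=> l0; apply: prodr_ge0 => x _; rewrite mulr_ge0. Qed.

Lemma hcwU l A B : [disjoint A & B] -> hcw l (A :|: B) = hcw l A * hcw l B.
Proof.
by move=> d; rewrite /hcw -bigU//; apply: eq_bigl => x; rewrite !inE.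
Qed.

Lemma hcZ_ge1 l T : 0 <= l -> 1 <= hcZ l T.
Proof.
move=> l0; rewrite /hcZ (bigD1 set0) /=; last first.
  by rewrite sub0set; apply/indepP => x y; rewrite inE.
by rewrite {1}/hcw big_set0 lerDl sumr_ge0// => A _; exact: hcw_ge0.
Qed.

(** Dropping independence leaves a sum over all subsets of [T], which is the product of the
    [1 + l * w x]. It is used backwards: a large partition function forces a large weight. *)
Lemma hcZ_le_expR l T : 0 <= l -> hcZ l T <= expR (l * wt T).
Proof.
move=> l0.
have -> : expR (l * wt T) = \prod_(x in T) expR (l * w x).
  by rewrite /wt mulr_sumr expR_sum.
apply: (@le_trans _ _ (\prod_(x in T) (1 + l * w x))); last first.
  apply: ler_prod => x _; rewrite addr_ge0 ?mulr_ge0//=; exact: expR_ge1Dx.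
rewrite big_mkcond (eq_bigr (fun x => (if x \in T then l * w x else 0) + 1)); last first.
  by move=> x _; case: ifP => _; rewrite ?add0r// addrC.
rewrite bigA_distr /hcZ big_mkcond; apply: ler_sum => A _.
have p0 : 0 <= \prod_i (if i \in A then if i \in T then l * w i else 0 else 1).
  by apply: prodr_ge0 => x _; case: ifP => //; case: ifP => // _ _; rewrite mulr_ge0.
case: ifP => // /andP[/subsetP AT _].
rewrite /hcw big_mkcond le_eqVlt; apply/orP; left; apply/eqP.
by apply: eq_bigr => x _; case: ifP => // /AT ->.
Qed.

(* Removing x from an independent set containing x leaves an independent set avoiding nb x. *)
Lemma hcSE l T g : hcS l T g = \sum_(x in T) l * w x * g x *
  \sum_(B : {set V} | [&& B \subset T, indep B & [disjoint B & nb x]]) hcw l B.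
Proof.
rewrite /hcS; under eq_bigr do rewrite mulr_sumr.
rewrite (exchange_big_dep (mem T)) /=; last first.
  by move=> A x /andP[/subsetP AT _] /AT.
apply: eq_bigr => x xT.
rewrite (reindex_onto (fun B => x |: B) (fun A => A :\ x)) /=; last first.
  by move=> A /andP[_ xA]; rewrite setD1K.
rewrite mulr_sumr; apply: eq_big => [B|B /andP[_ /eqP hB]]; last first.
  have xB : x \notin B by rewrite -hB !inE eqxx.
  by rewrite /hcw big_setU1//= -!mulrA; congr (_ * (_ * _)); rewrite mulrC.
have -> : ((x |: B) :\ x == B) = (x \notin B).
  by apply/eqP/idP => [<-|xB]; [rewrite !inE eqxx|rewrite setU1K].
rewrite setU11 andbT subUset sub1set xT /=.
case xB : (x \in B) => /=.
  rewrite andbF; apply/esym/negbTE; rewrite !negb_and; apply/orP; right.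
  apply/orP; right; apply/negP => /pred0P/(_ x); rewrite /= xB inE adjxx //.
rewrite andbT; congr (_ && _).
rewrite indepU ?disjoints1 ?xB//.
have -> : indep [set x] by apply/indepP => a b; rewrite !inE => /eqP -> /eqP ->.
rewrite /=; congr (_ && _).
by apply/forall_inP/idP => [|h y]; [apply; rewrite inE|rewrite inE => /eqP ->].
Qed.

(** In [hcSE] the inner sum is a part of the sum defining [hcZ]; completing it only adds nonnegative
    terms. *)
Lemma hcS_le l T g : 0 <= l -> (forall x, 0 <= g x) ->
  hcS l T g <= hcZ l T * \sum_(x in T) l * w x * g x.
Proof.
move=> l0 g0; rewrite hcSE mulrC mulr_suml; apply: ler_sum => x xT.
rewrite ler_wpM2l ?mulr_ge0//.
rewrite /hcZ [leRHS](bigID (fun B => [disjoint B & nb x])) /=.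
rewrite (eq_bigl (fun B => (B \subset T) && indep B && [disjoint B & nb x])).
  by rewrite lerDl sumr_ge0// => B _; exact: hcw_ge0.
by move=> B; rewrite andbA.
Qed.

(** By [hcSE], [x] is occupied with probability [l * w x] times the probability that the set avoids
    [nb x]. A union bound costs the expected number of occupied neighbours, which [hcS_le] estimates
    by the weight of adjacent pairs. *)
Lemma hcS_ge l T (p : R) : 0 <= l ->
  \sum_(x in T) \sum_(y in T) (adj x y)%:R * (w x * w y) <= p * wt T ^+ 2 ->
  hcZ l T * (l * wt T - (l * wt T) ^+ 2 * p) <= hcS l T (fun=> 1).
Proof.
move=> l0 hp.
pose g y := \sum_(x in T) l * w x * (adj x y)%:R.
have g0 y : 0 <= g y by apply: sumr_ge0 => x _; rewrite !mulr_ge0.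
suff h : hcZ l T * (l * wt T) - hcS l T g <= hcS l T (fun=> 1).
  apply: le_trans h; rewrite mulrBr lerD2l lerN2.
  apply: le_trans (hcS_le T l0 g0) _; rewrite ler_wpM2l ?(le_trans _ (hcZ_ge1 T l0))//.
  rewrite exprMn -mulrA [_ * p]mulrC.
  apply: le_trans (ler_wpM2l (sqr_ge0 l) hp); rewrite mulr_sumr.
  rewrite le_eqVlt; apply/orP; left; apply/eqP.
  apply: eq_bigr => x xT; rewrite /g mulr_sumr mulr_sumr.
  by apply: eq_bigr => y yT; rewrite adjC; ring.
rewrite [leRHS]hcSE /wt mulr_sumr mulr_sumr.
have -> : hcS l T g = \sum_(x in T) l * w x *
   \sum_(B : {set V} | (B \subset T) && indep B) hcw l B * \sum_(y in B) (adj x y)%:R.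
  rewrite /hcS /g.
  under eq_bigr do rewrite exchange_big mulr_sumr /=.
  rewrite exchange_big /=; apply: eq_bigr => x xT.
  rewrite mulr_sumr; apply: eq_bigr => B _; rewrite -mulr_sumr; ring.
rewrite -sumrB; apply: ler_sum => x xT.
rewrite mulr1 mulrC -mulrBr ler_wpM2l ?mulr_ge0//.
rewrite /hcZ -sumrB (bigID (fun B => [disjoint B & nb x])) /=.
rewrite -[leRHS]addr0; apply: lerD.
  rewrite le_eqVlt; apply/orP; left; apply/eqP.
  apply: eq_big => [B|B /andP[_ dB]]; first by rewrite -andbA.
  rewrite big1 ?mulr0 ?subr0// => y yB.
  by move/pred0P/(_ y) : dB; rewrite /= yB inE /= => ->.
apply: sumr_le0 => B /andP[_]; rewrite -setI_eq0 => /set0Pn[y].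
rewrite !inE => /andP[yB xy].
rewrite subr_le0 ler_peMr ?hcw_ge0// (bigD1 y)//= xy lerDl.
by apply: sumr_ge0.
Qed.

(** Chebyshev's sum inequality for similarly ordered [f] and [g]: the nonnegative double sum [X] is
    twice the difference of the two sides. *)
Lemma sum_chebyshev (I : finType) (P : pred I) (a f g : I -> R) :
  (forall i, P i -> 0 <= a i) ->
  (forall i j, P i -> P j -> 0 <= (f i - f j) * (g i - g j)) ->
  (\sum_(i | P i) a i * f i) * (\sum_(i | P i) a i * g i) <=
  (\sum_(i | P i) a i * f i * g i) * (\sum_(i | P i) a i).
Proof.
move=> a0 fg.
pose X := \sum_(i | P i) \sum_(j | P j) a i * a j * ((f i - f j) * (g i - g j)).
have X0 : 0 <= X.
  by apply: sumr_ge0 => i Pi; apply: sumr_ge0 => j Pj; rewrite mulr_ge0 ?fg// mulr_ge0 ?a0.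
suff : X = ((\sum_(i | P i) a i * f i * g i) * (\sum_(i | P i) a i) -
   (\sum_(i | P i) a i * f i) * (\sum_(i | P i) a i * g i)) *+ 2.
  by move=> E; rewrite E pmulrn_lge0 ?subr_ge0 in X0.
have E1 (b c : I -> R) : (\sum_(i | P i) b i) * (\sum_(j | P j) c j) =
    \sum_(i | P i) \sum_(j | P j) b i * c j.
  by rewrite mulr_suml; apply: eq_bigr => i _; rewrite mulr_sumr.
set A := \sum_(i | P i) a i * f i * g i; set B := \sum_(i | P i) a i.
set C := \sum_(i | P i) a i * f i; set D := \sum_(i | P i) a i * g i.
have -> : (A * B - C * D) *+ 2 = A * B + B * A - (C * D + D * C) by ring.
rewrite !E1 -!big_split -sumrB /=; apply: eq_bigr => i _.
by rewrite -!big_split -sumrB /=; apply: eq_bigr => j _; ring.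
Qed.

(** Passing from [l'] to [l] multiplies the weight of [A] by [(l / l') ^+ #|A|], which is ordered
    like [#|A|] itself, so Chebyshev's inequality applies. *)
Lemma hcS_mono l l' T : 0 < l' -> l' <= l ->
  hcS l' T (fun=> 1) * hcZ l T <= hcS l T (fun=> 1) * hcZ l' T.
Proof.
move=> l'0 ll'; have r1 : 1 <= l / l' by rewrite ler_pdivlMr ?mul1r.
have E A : hcw l A = hcw l' A * (l / l') ^+ #|A|.
  rewrite /hcw -prodr_const -big_split /=; apply: eq_bigr => x _.
  by rewrite mulrAC [l' * _]mulrC divfK ?gt_eqF.
rewrite /hcS /hcZ; under [X in _ * X]eq_bigr do rewrite E.
under [X in X * _ <= _]eq_bigr do rewrite sumr_const.
under [X in _ <= X * _]eq_bigr do rewrite E sumr_const mulrAC.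
apply: sum_chebyshev => [A _|A B _ _]; first exact/hcw_ge0/ltW.
have [AB|BA] := leqP #|A| #|B|.
  by rewrite mulr_le0// subr_le0 ?ler_nat// ler_weXn2l.
by rewrite mulr_ge0// subr_ge0 ?ler_nat ?(ltnW BA)// ler_weXn2l// ltnW.
Qed.

(* The mean increases with the activity, so the activity may be lowered until l * wt T = M. *)
Lemma hcS_ge_cond l T (D M p : R) : 0 < l -> 0 < M -> l * D <= M ->
  (forall T, D <= wt T ->
    \sum_(x in T) \sum_(y in T) (adj x y)%:R * (w x * w y) <= p * wt T ^+ 2) ->
  expR M <= hcZ l T -> hcZ l T * (M - M ^+ 2 * p) <= hcS l T (fun=> 1).
Proof.
move=> l0 M0 lD sp ZM.
(* The partition function bounds the weight from below, so [T] is heavy enough for the sparsity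
   hypothesis. *)
have MT : M <= l * wt T by rewrite -ler_expR (le_trans ZM)// hcZ_le_expR// ltW.
have T0 : 0 < wt T by rewrite -(pmulr_rgt0 _ l0) (lt_le_trans M0).
have DT : D <= wt T by rewrite -(ler_pM2l l0) (le_trans lD).
pose l' := M / wt T; have l'0 : 0 < l' by rewrite divr_gt0.
have ll' : l' <= l by rewrite ler_pdivrMr.
have := hcS_ge (ltW l'0) (sp _ DT); rewrite {2 3}/l' divfK ?gt_eqF// => h.
have Z'0 : 0 < hcZ l' T by apply: lt_le_trans (hcZ_ge1 T (ltW l'0)).
have Z0 : 0 < hcZ l T by apply: lt_le_trans (hcZ_ge1 T (ltW l0)).
rewrite -(ler_pM2r Z'0); apply: le_trans (hcS_mono T l'0 ll').
by rewrite -mulrA mulrC [X in X * _]mulrC ler_pM2r.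
Qed.

(** The spatial Markov property, without normalisation: [I] is cut into [J] outside [N] and [A]
    inside, and given [J] the admissible [A] are the independent subsets of the part of [N] that [J]
    leaves uncovered. *)
Lemma hc_decomp l N (F : {set V} -> R) :
  \sum_(I : {set V} | indep I) hcw l I * F (I :&: N) =
  \sum_(J : {set V} | indep J && [disjoint J & N]) hcw l J *
    \sum_(A : {set V} | (A \subset [set x in N | [disjoint J & nb x]]) && indep A)
       hcw l A * F A.
Proof.
rewrite (partition_big (fun I => I :\: N)
  (fun J => indep J && [disjoint J & N])) /=; last first.
  move=> I hI; rewrite (indepS (subsetDl _ _) hI) /=.
  by rewrite disjoint_subset; apply/subsetP => x; rewrite !inE => /andP[].
apply: eq_bigr => J /andP[iJ dJ].
rewrite (reindex_onto (fun A => J :|: A) (fun I => I :&: N)) /=; last first.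
  by move=> I /andP[_ /eqP <-]; rewrite setUC setID.
rewrite mulr_sumr; apply: eq_big => [A|A]; last first.
  move=> /andP[/andP[iJA /eqP JA] /eqP JA'].
  rewrite JA' hcwU ?mulrA//.
  rewrite -JA' disjoint_sym; apply: disjointWl (subsetIr _ _) _.
  by rewrite disjoint_sym.
have JN : J :&: N = set0 by apply/eqP; rewrite setI_eq0.
rewrite setDUl setIUl JN set0U.
have -> : J :\: N = J by apply/setDidPl.
have -> : (A :&: N == A) = (A \subset N) by apply/eqP/idP => /setIidPl.
case AN : (A \subset N); last first.
  rewrite andbF; apply/esym/negbTE; rewrite negb_and; apply/orP; left.
  apply/negP => /subsetP h; move/negP : AN; apply; apply/subsetP => x /h.
  by rewrite inE => /andP[].
have -> : A :\: N = set0 by apply/eqP; rewrite setD_eq0.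
rewrite setU0 eqxx !andbT.
have dJA : [disjoint A & J].
  by apply: disjointWl AN _; rewrite disjoint_sym.
rewrite setUC indepU// iJ /= andbC; congr (_ && _).
apply/forall_inP/subsetP => [h x xA|h x xA].
  by rewrite !inE h ?(subsetP AN).
by have := h _ xA; rewrite !inE => /andP[].
Qed.

(** The two alternatives are separated by the probability that a random [v] sees an uncovered part
    with partition function at least [expR M]. If it is at least [1 - e], the local counts give the
    first term; otherwise [nb v] is empty often enough to give the second. *)
Theorem hard_core_bound (s l D M p e : R) : 0 < s -> 0 < l -> 0 < M ->
  0 < e < 1 -> \sum_v w v = 1 ->
  (forall v, wt (nb v) <= s) ->
  (forall T, D <= wt T ->
    \sum_(x in T) \sum_(y in T) (adj x y)%:R * (w x * w y) <= p * wt T ^+ 2) ->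
  l * D <= M -> 0 <= M - M ^+ 2 * p ->
  exists2 I, indep I &
    Num.min ((1 - e) * (M - M ^+ 2 * p)) (e * (l * s * expR (- M))) <= #|I|%:R * s.
Proof.
move=> s0 l0 M0 /andP[e0 e1] w1 hs sp lD M'0.
set M' := M - _ in M'0 *.
pose Z := hcZ l setT; have Z0 : 0 < Z by apply: lt_le_trans (hcZ_ge1 _ (ltW l0)).
pose S := hcS l setT (fun=> 1).
pose TJ v J := [set x in nb v | [disjoint J & nb x]].
(* Up to the factor [Z], the probability that the uncovered part of [nb v] has partition function at
   least [expR M]. *)
pose Q v := \sum_(J : {set V} | indep J && [disjoint J & nb v])
   hcw l J * (if expR M <= hcZ l (TJ v J) then hcZ l (TJ v J) else 0).
have QM v : M' * Q v <= \sum_(I : {set V} | indep I) hcw l I * #|I :&: nb v|%:R.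
  rewrite (hc_decomp l (nb v) (fun A => #|A|%:R)) /Q mulr_sumr.
  apply: ler_sum => J _; rewrite mulrCA ler_wpM2l ?hcw_ge0 ?(ltW l0)//.
  have -> : \sum_(A : {set V} | (A \subset [set x in nb v | [disjoint J & nb x]]) &&
       indep A) hcw l A * #|A|%:R = hcS l (TJ v J) (fun=> 1).
    by apply: eq_bigr => A _; rewrite sumr_const.
  case: ifP => hM; first by rewrite mulrC; exact: (@hcS_ge_cond _ _ D).
  rewrite mulr0; apply: sumr_ge0 => A _; rewrite mulr_ge0 ?hcw_ge0 ?(ltW l0)//.
  by apply: sumr_ge0.
(* When the uncovered part has partition function below [expR M], the conditional probability that
   it contains no point exceeds [expR (- M)]. *)
have QZ v : expR (- M) * (Z - Q v) <=
    \sum_(J : {set V} | indep J && [disjoint J & nb v]) hcw l J.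
  have -> : Z = \sum_(J : {set V} | indep J && [disjoint J & nb v])
      hcw l J * hcZ l (TJ v J).
    rewrite /Z /hcZ.
    under eq_bigl do rewrite subsetT /=.
    under eq_bigr do rewrite -[hcw _ _]mulr1.
    rewrite (hc_decomp l (nb v) (fun=> 1)); apply: eq_bigr => J _; congr (_ * _).
    by apply: eq_bigr => A _; rewrite mulr1.
  rewrite /Q -sumrB mulr_sumr; apply: ler_sum => J _.
  rewrite -mulrBr mulrCA ler_piMr ?hcw_ge0 ?(ltW l0)//.
  case: ifP => hM; first by rewrite subrr mulr0.
  rewrite subr0 expRN mulrC ler_pdivrMr ?expR_gt0// mul1r ltW//.
  by rewrite ltNge hM.
have SE : S = \sum_(I : {set V} | indep I) hcw l I * #|I|%:R.
  rewrite /S /hcS; under eq_bigl do rewrite subsetT /=.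
  by apply: eq_bigr => I _; rewrite sumr_const.
pose q := \sum_v w v * Q v.
have h1 : M' * q <= s * S.
  rewrite /q mulr_sumr.
  apply: (@le_trans _ _ (\sum_v w v *
      \sum_(I : {set V} | indep I) hcw l I * #|I :&: nb v|%:R)).
    by apply: ler_sum => v _; rewrite mulrCA ler_wpM2l.
  under eq_bigr do rewrite mulr_sumr.
  rewrite exchange_big SE mulr_sumr /=; apply: ler_sum => I _.
  under eq_bigr do rewrite mulrCA.
  rewrite -mulr_sumr mulrCA ler_wpM2l ?hcw_ge0 ?(ltW l0)//.
  (* Double counting: a point [x] of [I] is seen from the vertices of [nb x], whose total weight is
     at most [s]. *)
  have -> : s * #|I|%:R = \sum_(x in I) s by rewrite sumr_const mulr_natr.
  apply: (@le_trans _ _ (\sum_(x in I) wt (nb x))); last exact: ler_sum.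
  rewrite le_eqVlt; apply/orP; left; apply/eqP; rewrite /wt.
  rewrite (exchange_big_dep xpredT) //=; apply: eq_bigr => v _.
  rewrite -sum1_card natr_sum mulr_sumr; apply: eq_big => [x|x _]; last by rewrite mulr1.
  by rewrite !inE adjC.
have h2 : l * expR (- M) * (Z - q) <= S.
  have -> : Z - q = \sum_v w v * (Z - Q v).
    rewrite /q; under [RHS]eq_bigr do rewrite mulrBr.
    by rewrite sumrB -mulr_suml w1 mul1r.
  rewrite /S hcSE mulr_sumr big_mkcond /=.
  rewrite [leRHS]big_mkcond /=; apply: ler_sum => v _; rewrite inE mulr1.
  have -> : l * expR (- M) * (w v * (Z - Q v)) = l * w v * (expR (- M) * (Z - Q v)).
    by ring.
  rewrite ler_wpM2l ?mulr_ge0 ?(ltW l0)// (le_trans (QZ v))//.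
  rewrite le_eqVlt; apply/orP; left; apply/eqP; apply: eq_bigl => J.
  by rewrite subsetT.
have hS : Num.min ((1 - e) * M') (e * (l * s * expR (- M))) * Z <= s * S.
  have [hq|hq] := leP ((1 - e) * Z) q.
    apply: le_trans h1; apply: (@le_trans _ _ ((1 - e) * M' * Z)).
      by rewrite ler_pM2r// ge_min lexx.
    by rewrite mulrAC mulrC ler_wpM2l.
  apply: (@le_trans _ _ (e * (l * s * expR (- M)) * Z)).
    by rewrite ler_pM2r// ge_min lexx orbT.
  apply: (@le_trans _ _ (s * (l * expR (- M) * (Z - q)))); last by rewrite ler_pM2l.
  have -> : e * (l * s * expR (- M)) * Z = s * (l * expR (- M) * (e * Z)) by ring.
  rewrite ler_pM2l// ler_wpM2l ?mulr_ge0 ?expR_ge0 ?(ltW l0)//.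
  by move: hq; rewrite mulrBl mul1r; lra.
have i0 : indep set0 by apply/indepP => x y; rewrite inE.
pose I0 := [arg max_(I > set0 | indep I) #|I|].
have [iI0 maxI0] : indep I0 /\ forall I, indep I -> (#|I| <= #|I0|)%N.
  by rewrite /I0; case: arg_maxnP.
exists I0 => //; rewrite -(ler_pM2r Z0); apply: le_trans hS _.
rewrite -mulrA mulrCA ler_pM2l// SE.
rewrite /Z /hcZ mulr_sumr; under [leRHS]eq_bigl do rewrite subsetT /=.
apply: ler_sum => I iI; rewrite mulrC ler_wpM2r ?hcw_ge0 ?(ltW l0)//.
by rewrite ler_nat maxI0.
Qed.

End HardCore.

(** * Sparsity of sets of close points *)

(** Vectors are functions on [nat] of which only the first [d] values are read, so the induction on
    the dimension needs no change of type. *)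
Definition dot (R : realType) (d : nat) (x y : nat -> R) : R := \sum_(i < d) x i * y i.

Section Dot.
Variables (R : realType) (d : nat).
Implicit Types (x y : nat -> R) (a : R).

Lemma dotC x y : dot d x y = dot d y x.
Proof. by apply: eq_bigr => i _; rewrite mulrC. Qed.

Lemma dot_ge0 x : 0 <= dot d x x.
Proof. by apply: sumr_ge0 => i _; rewrite -expr2 sqr_ge0. Qed.

Lemma dotZr a x y : dot d x (fun i => a * y i) = a * dot d x y.
Proof. by rewrite /dot mulr_sumr; apply: eq_bigr => i _; ring. Qed.

Lemma dotZl a x y : dot d (fun i => a * x i) y = a * dot d x y.
Proof. by rewrite dotC dotZr dotC. Qed.

Lemma dot_sumr (I : finType) x (f : I -> nat -> R) :
  dot d x (fun j => \sum_i f i j) = \sum_i dot d x (f i).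
Proof.
by rewrite /dot exchange_big; apply: eq_bigr => i _; rewrite mulr_sumr.
Qed.

Lemma dot_normalize x : 0 < dot d x x ->
  dot d (fun i => (Num.sqrt (dot d x x))^-1 * x i)
        (fun i => (Num.sqrt (dot d x x))^-1 * x i) = 1.
Proof.
move=> x0; rewrite dotZl dotZr mulrA -expr2 exprVn sqr_sqrtr ?ltW//.
by rewrite mulVf ?gt_eqF.
Qed.

Lemma dot_eq0 x y : dot d x x = 0 -> dot d y x = 0.
Proof.
move=> /eqP; rewrite psumr_eq0 => [/allP h|i _]; last by rewrite -expr2 sqr_ge0.
apply: big1 => i _; have := h i (mem_index_enum i).
by rewrite /= mulf_eq0 orbb => /eqP ->; rewrite mulr0.
Qed.

Lemma dot_norm_le1 x y : dot d x x <= 1 -> dot d y y <= 1 -> -1 <= dot d x y <= 1.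
Proof.
move=> x1 y1.
have h1 : 0 <= dot d (fun i => x i - y i) (fun i => x i - y i) by exact: dot_ge0.
have h2 : 0 <= dot d (fun i => x i + y i) (fun i => x i + y i) by exact: dot_ge0.
have E1 : dot d (fun i => x i - y i) (fun i => x i - y i) =
    dot d x x + dot d y y - 2 * dot d x y.
  by rewrite /dot mulr_sumr -big_split -sumrB; apply: eq_bigr => i _ /=; ring.
have E2 : dot d (fun i => x i + y i) (fun i => x i + y i) =
    dot d x x + dot d y y + 2 * dot d x y.
  by rewrite /dot mulr_sumr -!big_split; apply: eq_bigr => i _ /=; ring.
by apply/andP; split; lra.
Qed.

End Dot.

Section Sparse.
Import mathcomp.boot.fintype mathcomp.boot.finset.
Local Close Scope classical_set_scope.
Variables (R : realType) (d : nat) (V : finType) (w : V -> R) (u : V -> nat -> R).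
Hypothesis w_ge0 : forall v, 0 <= w v.
Hypothesis w_sum : \sum_v w v = 1.
Variables (E0 dl kap : R).
Hypothesis dl01 : 0 <= dl <= 1.
Hypothesis kap0 : 0 < kap.
(** The tilt is adapted to 45 degrees: where [dot d (u v) x] is at least [1 / Num.sqrt 2], the
    exponential is at least [expR d%:R]. *)
Hypothesis exp_moment : forall x, dot d x x = 1 ->
  \sum_v w v * expR (Num.sqrt 2 * d%:R * dot d (u v) x) <= E0.
Hypothesis cap_mass : forall x, dot d x x = 1 ->
  kap <= \sum_(v | 1 - dl <= dot d (u v) x) w v.
Hypothesis u_unit : forall v, dot d (u v) (u v) = 1.

Let r2 : R := Num.sqrt 2.
Let r2_gt0 : 0 < r2. Proof. by rewrite sqrtr_gt0. Qed.
Let r2K : r2 ^+ 2 = 2. Proof. by rewrite sqr_sqrtr. Qed.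

Definition tup_sum k (f : {ffun 'I_k -> V}) : nat -> R := fun j => \sum_i u (f i) j.

(* Testing against a random direction v, every long sum vector is detected by a
   proportion [kap] of the directions, and for a fixed direction Chernoff applies. *)
Lemma long_sum_mass k : (0 < k)%N ->
  \sum_(f : {ffun 'I_k -> V} | k%:R ^+ 2 / 2 <= dot d (tup_sum f) (tup_sum f))
     \prod_i w (f i) <=
  kap^-1 * (E0 * expR (- (d%:R * (1 - dl)))) ^+ k.
Proof.
move=> k0; rewrite [leRHS]mulrC ler_pdivlMr//.
(* The exponent [r2 * d%:R * dot d (u v) (tup_sum f)] reaches [c] as soon as the sum has length at
   least [k / r2] and makes a cosine of at least [1 - dl] with [u v]. *)
pose c : R := d%:R * k%:R * (1 - dl).
apply: (@le_trans _ _ (\sum_(f : {ffun 'I_k -> V}) (\prod_i w (f i)) *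
   \sum_v w v * (expR (r2 * d%:R * dot d (u v) (tup_sum f)) * expR (- c)))).
  rewrite mulr_suml [leLHS]big_mkcond /=; apply: ler_sum => f _.
  have pf : 0 <= \prod_i w (f i) by apply: prodr_ge0.
  case: ifP => hf; last first.
    rewrite mulr_ge0// sumr_ge0// => v _; by rewrite !mulr_ge0 ?expR_ge0.
  rewrite ler_wpM2l//.
  set U := tup_sum f in hf *.
  have U0 : 0 < dot d U U.
    by apply: lt_le_trans hf; rewrite divr_gt0 ?exprn_gt0// ltr0n.
  set n := Num.sqrt (dot d U U).
  have n0 : 0 < n by rewrite sqrtr_gt0.
  have nk : k%:R / r2 <= n.
    rewrite -(@ler_pXn2r _ 2)// ?nnegrE ?divr_ge0 ?(ltW n0) ?(ltW r2_gt0)//.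
    by rewrite /n sqr_sqrtr ?(ltW U0)// exprMn exprVn r2K.
  apply: le_trans (cap_mass (dot_normalize U0)) _.
  rewrite big_mkcond; apply: ler_sum => v _.
  case: ifP => hv; last by rewrite !mulr_ge0 ?expR_ge0.
  rewrite ler_peMr// -expRD -[leLHS]expR0 ler_expR.
  move: hv; rewrite dotZr mulrC ler_pdivlMr// => hv.
  have : (1 - dl) * (k%:R / r2) <= dot d (u v) U.
    apply: le_trans hv; rewrite ler_wpM2l//; by case/andP: dl01; lra.
  move=> h; rewrite subr_ge0 /c.
  have -> : d%:R * k%:R * (1 - dl) = r2 * d%:R * ((1 - dl) * (k%:R / r2)).
    by field; rewrite gt_eqF.
  by rewrite ler_wpM2l// mulr_ge0// ltW.
(* For a fixed direction [v] the exponential factors over the entries of the tuple, so the sum over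
   tuples is a [k]-th power. *)
have -> : \sum_(f : {ffun 'I_k -> V}) (\prod_i w (f i)) *
   (\sum_v w v * (expR (r2 * d%:R * dot d (u v) (tup_sum f)) * expR (- c))) =
   \sum_v w v * expR (- c) *
     (\sum_a w a * expR (r2 * d%:R * dot d (u v) (u a))) ^+ k.
  under eq_bigr do rewrite mulr_sumr.
  rewrite exchange_big /=; apply: eq_bigr => v _.
  rewrite -[in X in _ ^+ X](card_ord k) -prodr_const bigA_distr_bigA /=.
  rewrite mulr_sumr; apply: eq_bigr => f _.
  rewrite big_split /= -expR_sum /tup_sum dot_sumr mulr_sumr.
  ring.
have -> : (E0 * expR (- (d%:R * (1 - dl)))) ^+ k = \sum_v w v * expR (- c) * E0 ^+ k.
  rewrite -!mulr_suml w_sum mul1r exprMn mulrC -expRM_natl; congr (expR _ * _).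
  by rewrite /c; ring.
apply: ler_sum => v _; rewrite ler_wpM2l ?mulr_ge0 ?expR_ge0//.
under eq_bigr do rewrite dotC.
have s0 : 0 <= \sum_a w a * expR (r2 * d%:R * dot d (u a) (u v)).
  by apply: sumr_ge0 => a _; rewrite mulr_ge0 ?expR_ge0.
by rewrite lerXn2r ?nnegrE ?(le_trans s0)// exp_moment.
Qed.

Definition close : rel V := fun x y => 1 / 2 <= dot d (u x) (u y).

(** Jensen's inequality for the power [k], cleared of denominators. Each induction step is
    Chebyshev's inequality for [g] and [g ^+ k]. *)
Lemma power_mean (T : {set V}) (g : V -> R) k : (forall v, 0 <= g v) ->
  (\sum_(y in T) w y * g y) ^+ k * wt w T <= wt w T ^+ k * \sum_(y in T) w y * g y ^+ k.
Proof.
move=> g0; elim: k => [|k IH].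
  by rewrite !expr0 !mul1r /wt; under [leRHS]eq_bigr do rewrite mulr1.
have T0 : 0 <= wt w T by exact: sumr_ge0.
rewrite !exprS -!mulrA; apply: (@le_trans _ _ ((\sum_(y in T) w y * g y) *
   (wt w T ^+ k * \sum_(y in T) w y * g y ^+ k))).
  by rewrite ler_wpM2l// sumr_ge0// => y _; rewrite mulr_ge0.
rewrite mulrCA [leRHS]mulrCA ler_wpM2l ?exprn_ge0//.
have := @sum_chebyshev R V (mem T) w g (fun y => g y ^+ k).
rewrite [X in _ -> _ -> _ <= X]mulrC.
have -> : \sum_(i in T) w i * g i * g i ^+ k = \sum_(i in T) w i * g i ^+ k.+1.
  by apply: eq_bigr => i _; rewrite exprS mulrA.
apply => // i j _ _; have [ij|ji] := leP (g i) (g j).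
  by rewrite mulr_le0// subr_le0// lerXn2r// nnegrE.
by rewrite mulr_ge0// subr_ge0 ?(ltW ji)// lerXn2r ?nnegrE// ltW.
Qed.

(** The condition on [c] places the region inside the 45 degree cap around [x], where the
    exponential moment is bounded pointwise by [expR d%:R] from below. *)
Lemma half_cap_mass x : 0 < dot d x x -> forall c : R, dot d x x <= 2 * c ^+ 2 ->
  0 < c -> \sum_(v | c <= dot d (u v) x) w v <= E0 * expR (- d%:R).
Proof.
move=> x0 c xc c0.
apply: le_trans (ler_wpM2r (expR_ge0 _) (exp_moment (dot_normalize x0))).
rewrite mulr_suml big_mkcond; apply: ler_sum => v _.
case: ifP => hv; last by rewrite !mulr_ge0 ?expR_ge0.
rewrite -[leRHS]mulrA ler_peMr// -expRD -[leLHS]expR0 ler_expR subr_ge0 dotZr.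
have n0 : 0 < Num.sqrt (dot d x x) by rewrite sqrtr_gt0.
have hn : Num.sqrt (dot d x x) <= r2 * c.
  rewrite -(@ler_pXn2r _ 2)// ?nnegrE ?mulr_ge0 ?(ltW n0) ?(ltW c0) ?(ltW r2_gt0)//.
  by rewrite sqr_sqrtr ?(ltW x0)// exprMn r2K.
have h : 1 <= r2 * ((Num.sqrt (dot d x x))^-1 * dot d (u v) x).
  rewrite mulrCA -ler_pdivrMl ?invr_gt0// invrK mulr1.
  by rewrite (le_trans hn)// ler_pM2l.
rewrite -mulrA mulrCA -[leLHS]mulr1; exact: ler_wpM2l h.
Qed.

(* If a pair of points of T is close with probability p, then k + 1 random points
   form a star with probability at least p ^ k; the sum of the k leaves is then either
   unusually long, or the centre lies in the 45 degree cap around its direction. *)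
Theorem close_pairs_sparse k (D p : R) (T : {set V}) : (0 < k)%N -> 0 < D -> 0 <= p ->
  kap^-1 * (E0 * expR (- (d%:R * (1 - dl))) / D) ^+ k + E0 * expR (- d%:R) / D <= p ^+ k ->
  D <= wt w T ->
  \sum_(x in T) \sum_(y in T) (close x y)%:R * (w x * w y) <= p * wt w T ^+ 2.
Proof.
move=> k0 D0 p0 hp DT.
have T0 : 0 < wt w T by apply: lt_le_trans DT.
pose g y := \sum_(x in T) (close x y)%:R * w x.
have g0 y : 0 <= g y by apply: sumr_ge0 => x _; rewrite mulr_ge0.
have -> : \sum_(x in T) \sum_(y in T) (close x y)%:R * (w x * w y) =
    \sum_(y in T) w y * g y.
  rewrite exchange_big; apply: eq_bigr => y _; rewrite mulr_sumr.
  by apply: eq_bigr => x _; ring.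
have S0 : 0 <= \sum_(y in T) w y * g y by apply: sumr_ge0 => y _; rewrite mulr_ge0.
(* Taking [k]-th powers brings in the sum of [w y * g y ^+ k], the weight of stars with centre [y]
   and [k] leaves in [T]. *)
rewrite -(@ler_pXn2r _ k)// ?nnegrE ?mulr_ge0 ?sqr_ge0 ?(ltW T0)//.
rewrite -(ler_pM2r T0); apply: le_trans (power_mean T k g0) _.
set L := kap^-1 * (E0 * expR (- (d%:R * (1 - dl)))) ^+ k.
set C := E0 * expR (- d%:R).
have L0 : 0 <= L.
  by apply: le_trans (long_sum_mass k0); apply: sumr_ge0 => f _; apply: prodr_ge0.
have C0 : 0 <= C.
  rewrite mulr_ge0 ?expR_ge0//.
  have [v _|noV] := pickP (mem T); last first.
    by move: T0; rewrite /wt big_pred0 ?ltxx.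
  apply: le_trans (exp_moment (u_unit v)).
  by apply: sumr_ge0 => a _; rewrite mulr_ge0 ?expR_ge0.
have star : \sum_(y in T) w y * g y ^+ k <= wt w T * L + wt w T ^+ k * C.
  pose wT (f : {ffun 'I_k -> V}) := \prod_i ((f i \in T)%:R * w (f i)).
  have wT_ge0 f : 0 <= wT f by apply: prodr_ge0 => i _; rewrite mulr_ge0.
  have wTle f : wT f <= \prod_i w (f i).
    by apply: ler_prod => i _; rewrite mulr_ge0//=; case: (_ \in _); rewrite ?mul1r ?mul0r.
  have -> : \sum_(y in T) w y * g y ^+ k =
      \sum_(f : {ffun 'I_k -> V}) wT f * \sum_(y in T) w y * \prod_i (close (f i) y)%:R.
    under [RHS]eq_bigr do rewrite mulr_sumr.
    rewrite exchange_big /=; apply: eq_bigr => y _.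
    rewrite -[in LHS](card_ord k) -prodr_const /g.
    have -> : \sum_(x in T) (close x y)%:R * w x =
        \sum_x (x \in T)%:R * w x * (close x y)%:R.
      rewrite big_mkcond; apply: eq_bigr => x _.
      by case: (x \in T); rewrite ?mul1r ?mul0r// mulrC.
    rewrite bigA_distr_bigA mulr_sumr /=; apply: eq_bigr => f _.
    by rewrite big_split /= -/(wT f); ring.
  have -> : wt w T ^+ k = \sum_f wT f.
    rewrite /wT -(bigA_distr_bigA (fun (_ : 'I_k) x => (x \in T)%:R * w x)).
    rewrite prodr_const card_ord /wt big_mkcond /=; congr (_ ^+ _).
    by apply: eq_bigr => x _; case: (x \in T); rewrite ?mul1r ?mul0r.
  rewrite (bigID (fun f => k%:R ^+ 2 / 2 <= dot d (tup_sum f) (tup_sum f))) /=.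
  apply: lerD.
    rewrite [leRHS]mulrC; apply: (@le_trans _ _ (\sum_(f : {ffun 'I_k -> V} |
        k%:R ^+ 2 / 2 <= dot d (tup_sum f) (tup_sum f)) (\prod_i w (f i)) * wt w T)).
      apply: ler_sum => f _; apply: ler_pM => //.
        by apply: sumr_ge0 => y _; rewrite mulr_ge0// prodr_ge0.
      apply: ler_sum => y _; rewrite ler_piMr// prodr_ile1// => i _.
      by rewrite ler0n lern1 leq_b1.
    by rewrite -mulr_suml ler_pM2r// long_sum_mass.
  rewrite mulr_suml big_mkcond; apply: ler_sum => f _.
  case: ifPn => hf; last by rewrite mulr_ge0.
  rewrite -ltNge in hf; rewrite ler_wpM2l//.
  set U := tup_sum f in hf *.
  have kR : 0 < k%:R / 2 :> R by rewrite divr_gt0// ltr0n.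
  have cl y : (forall i, close (f i) y) -> k%:R / 2 <= dot d (u y) U.
    move=> h; rewrite /U dot_sumr.
    apply: (@le_trans _ _ (\sum_(i < k) (1 / 2) : R)).
      by rewrite sumr_const card_ord -[leRHS]mulr_natl mul1r.
    by apply: ler_sum => i _; rewrite dotC; exact: h.
  apply: (@le_trans _ _ (\sum_(v | k%:R / 2 <= dot d (u v) U) w v)).
    rewrite big_mkcond [leRHS]big_mkcond; apply: ler_sum => y _.
    case: ifP => yT; last by case: ifP.
    case: (pickP (fun i => ~~ close (f i) y)) => [i hi|h].
      by rewrite (bigD1 i)//= (negbTE hi) mul0r mulr0; case: ifP.
    rewrite ifT; first by rewrite ler_piMr// prodr_ile1// => i _; rewrite ler0n lern1 leq_b1.
    by apply: cl => i; have /negbFE := h i.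
  (* A vanishing sum has no direction, but then no point has inner product [k%:R / 2] with it. *)
  have [U0|U0] := eqVneq (dot d U U) 0.
    rewrite big_pred0// => v; apply/negbTE; rewrite -ltNge dot_eq0//.
  have {}U0 : 0 < dot d U U by rewrite lt0r U0 dot_ge0.
  apply: half_cap_mass => //; apply: le_trans (ltW hf) _.
  by rewrite le_eqVlt; apply/orP; left; apply/eqP; field.
apply: le_trans (ler_wpM2l (exprn_ge0 _ (ltW T0)) star) _.
rewrite exprMn.
apply: (@le_trans _ _ ((L / D ^+ k + C / D) * (wt w T ^+ 2) ^+ k * wt w T)); last first.
  rewrite ler_pM2r// ler_wpM2r ?exprn_ge0 ?sqr_ge0 ?(ltW T0)//.
  by apply: le_trans hp; rewrite /L expr_div_n mulrA.
have E (a b t : R) : t != 0 -> t ^+ k * (t * a + t ^+ k * b) =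
    (a / t ^+ k + b / t) * (t ^+ 2) ^+ k * t.
  by move=> t0; rewrite -exprM mulnC exprM expr2; field; rewrite t0 expf_neq0.
rewrite E ?gt_eqF// ler_pM2r// ler_wpM2r ?exprn_ge0 ?sqr_ge0 ?(ltW T0)//.
apply: lerD; rewrite ler_wpM2l// lef_pV2 ?posrE ?exprn_gt0//.
by rewrite lerXn2r ?nnegrE ?(ltW T0) ?(ltW D0).
Qed.

End Sparse.

(** * Integrals of powers of sine and cosine *)

Section Integral.
Variable R : realType.
Implicit Types (f g F G : R -> R) (a b x : R).

(* The base point -4 lies to the left of the interval [-pi/2, pi/2] of integration. *)
Definition prim f x : R := (\int[lebesgue_measure]_(t in `[(-4), x]) f t)%R.
Definition itg f a b := prim f b - prim f a.

Lemma is_derive_prim f x : continuous f -> -4 < x -> is_derive x 1 (prim f) (f x).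
Proof.
move=> cf x4.
have xu : x < x + 1 by rewrite ltrDl.
have [] := @continuous_FTC1_closed R f (-4) x (x + 1) xu _ x4 (cf x).
  apply: continuous_compact_integrable; first exact: segment_compact.
  exact: continuous_subspaceT.
by move=> df E; apply: DeriveDef; [exact: df|rewrite -derive1E; exact: E].
Qed.

(** The mean value theorem for [G - F]. Both [itg_FTC] and [le_itg] follow from it, so after
    [is_derive_prim] integrals are handled through derivatives alone. *)
Lemma derive_le_diff F G f g a b : a <= b ->
  (forall x, a <= x <= b -> is_derive x 1 F (f x)) ->
  (forall x, a <= x <= b -> is_derive x 1 G (g x)) ->
  (forall x, a < x < b -> f x <= g x) -> F b - F a <= G b - G a.
Proof.
move=> ab dF dG fg.
move: ab; rewrite le_eqVlt => /predU1P[->|ab]; first by rewrite !subrr.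
have dGF x : a <= x <= b -> is_derive x 1 (G - F) (g x - f x).
  by move=> xab; have := dF _ xab; have := dG _ xab => h1 h2; exact: is_deriveB.
have [||c] := @MVT _ (G - F) (fun x => g x - f x) a b ab.
- by move=> x /[!in_itv]/= /andP[ax xb]; apply: dGF; rewrite !ltW.
- apply: continuous_in_subspaceT => x /[!inE]/= /[!in_itv]/= xab.
  by apply/differentiable_continuous/derivable1_diffP; case: (dGF x xab).
rewrite in_itv /= => /fg; rewrite -subr_ge0 => h E.
have : 0 <= (G - F) b - (G - F) a by rewrite E mulr_ge0// subr_ge0 ltW.
rewrite !fctE; lra.
Qed.

Definition primitive_on F f a b := forall x, a <= x <= b -> is_derive x 1 F (f x).

Lemma itg_FTC F f a b : continuous f -> -4 < a -> a <= b ->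
  primitive_on F f a b -> itg f a b = F b - F a.
Proof.
move=> cf a4 ab dF.
have dp x : a <= x <= b -> is_derive x 1 (prim f) (f x).
  by move=> /andP[ax _]; apply: is_derive_prim => //; exact: lt_le_trans ax.
by apply/eqP; rewrite eq_le; apply/andP; split; apply: (@derive_le_diff _ _ f f).
Qed.

Lemma le_itg f g a b : continuous f -> continuous g -> -4 < a -> a <= b ->
  (forall x, a < x < b -> f x <= g x) -> itg f a b <= itg g a b.
Proof.
move=> cf cg a4 ab fg; apply: (derive_le_diff ab) fg => x /andP[ax _];
  by apply: is_derive_prim => //; exact: lt_le_trans ax.
Qed.

Lemma itg_cat f a b c : itg f a b + itg f b c = itg f a c.
Proof. by rewrite /itg; ring. Qed.

Lemma itgD f g a b : continuous f -> continuous g -> -4 < a -> a <= b ->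
  itg (fun x => f x + g x) a b = itg f a b + itg g a b.
Proof.
move=> cf cg a4 ab; rewrite (@itg_FTC (prim f + prim g)) //.
- by rewrite /itg !fctE; ring.
- by move=> x; apply: cvgD; [exact: cf|exact: cg].
- move=> x /andP[ax _]; have x4 := lt_le_trans a4 ax.
  have := is_derive_prim cf x4; have := is_derive_prim cg x4 => h1 h2.
  exact: is_deriveD.
Qed.

Lemma itgZ f k a b : continuous f -> -4 < a -> a <= b ->
  itg (fun x => k * f x) a b = k * itg f a b.
Proof.
move=> cf a4 ab; rewrite (@itg_FTC (k *: prim f)) //.
- by rewrite /itg !fctE /GRing.scale /=; ring.
- by move=> x; apply: cvgM; [exact: cvg_cst|exact: cf].
- move=> x /andP[ax _]; have x4 := lt_le_trans a4 ax.
  by have := is_derive_prim cf x4 => h1; exact: is_deriveZ.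
Qed.

Lemma itg_cst k a b : -4 < a -> a <= b -> itg (fun=> k) a b = k * (b - a).
Proof.
move=> a4 ab; rewrite (@itg_FTC (k *: id)) //.
- by rewrite !fctE /GRing.scale /=; ring.
- by move=> x; exact: cvg_cst.
- by move=> x _; apply: is_derive_eq; rewrite /GRing.scale /= mulr1.
Qed.

Lemma continuous_sumr n (f : 'I_n -> R -> R) : (forall i, continuous (f i)) ->
  continuous (fun x => \sum_i f i x).
Proof.
elim: n f => [|n IH] f cf.
  by under eq_fun do rewrite big_ord0; exact: cst_continuous.
under eq_fun do rewrite big_ord_recl; move=> x.
apply: cvgD; first exact: cf.
by apply: IH => i; exact: cf.
Qed.

Lemma itg_sum n (f : 'I_n -> R -> R) a b : (forall i, continuous (f i)) ->
  -4 < a -> a <= b -> itg (fun x => \sum_i f i x) a b = \sum_i itg (f i) a b.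
Proof.
move=> cf a4 ab; elim: n f cf => [|n IH] f cf.
  by under eq_fun do rewrite big_ord0; rewrite itg_cst// big_ord0 mul0r.
under eq_fun do rewrite big_ord_recl; rewrite itgD//.
  by rewrite IH// big_ord_recl.
by apply: continuous_sumr => i; exact: cf.
Qed.

End Integral.

Section Trigo.
Variable R : realType.
Implicit Types (x : R) (a b n : nat).

Let hp : R := pi / 2.
Let hp4 : -4 < - hp. Proof. by have := @pihalf_lt2 R; rewrite /hp; lra. Qed.
Let hple : - hp <= hp. Proof. by have := @pihalf_ge1 R; rewrite /hp; lra. Qed.

Definition sc a b x : R := sin x ^+ a * cos x ^+ b.

Lemma continuous_sc a b : continuous (sc a b).
Proof.
move=> x; apply: cvgM.
  apply: (@continuous_comp _ _ _ (@sin R) (fun y => y ^+ a)); first exact: continuous_sin.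
  exact: exprn_continuous.
apply: (@continuous_comp _ _ _ (@cos R) (fun y => y ^+ b)); first exact: continuous_cos.
exact: exprn_continuous.
Qed.

Lemma is_derive_sc a b x : is_derive x 1 (sc a b)
  (a%:R * sin x ^+ a.-1 * cos x ^+ b.+1 - b%:R * sin x ^+ a.+1 * cos x ^+ b.-1).
Proof.
have -> : sc a b = (sin ^+ a) * (cos ^+ b) :> (R -> R).
  by apply/funext => y; rewrite /sc !fctE.
apply: is_derive_eq; rewrite /GRing.scale /= !exprfctE !exprS; ring.
Qed.

Definition trig_int a b : R := itg (sc a b) (- hp) hp.

Lemma trig_int_split a b : trig_int a b.+2 + trig_int a.+2 b = trig_int a b.
Proof.
rewrite /trig_int -itgD//; [|exact: continuous_sc..].
congr (itg _ _ _); apply/funext => x; rewrite /sc.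
by rewrite -[RHS]mulr1 -(cos2Dsin2 x) !exprS; ring.
Qed.

(** The difference of the two sides integrates the derivative of [sc a.+1 b.+1], which vanishes at
    both ends because of its cosine factor. *)
Lemma trig_int_parts a b : a.+1%:R * trig_int a b.+2 = b.+1%:R * trig_int a.+2 b.
Proof.
apply/eqP; rewrite -subr_eq0 /trig_int -!itgZ//; [|exact: continuous_sc..].
have -> : itg (fun x => a.+1%:R * sc a b.+2 x) (- hp) hp -
    itg (fun x => b.+1%:R * sc a.+2 b x) (- hp) hp =
    itg (fun x => a.+1%:R * sc a b.+2 x + (- b.+1%:R) * sc a.+2 b x) (- hp) hp.
  rewrite itgD// ?itgZ//; try exact: continuous_sc.
  - ring.
  - by move=> x; apply: cvgM; [exact: cvg_cst|exact: continuous_sc].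
  - by move=> x; apply: cvgM; [exact: cvg_cst|exact: continuous_sc].
rewrite (@itg_FTC _ (sc a.+1 b.+1))//.
- by rewrite /sc !cosN cos_pihalf expr0n /= !mulr0 subrr.
- move=> x; apply: cvgD; apply: cvgM; (try exact: cvg_cst); exact: continuous_sc.
- move=> x _; apply: is_derive_eq; first exact: is_derive_sc.
  by rewrite /sc /=; ring.
Qed.

Lemma trig_int_sin a b : trig_int a.+2 b = a.+1%:R / (a + b).+2%:R * trig_int a b.
Proof.
have n0 : (a + b).+2%:R != 0 :> R by rewrite pnatr_eq0.
move: (trig_int_split a b) (trig_int_parts a b).
move: (trig_int a b) (trig_int a b.+2) (trig_int a.+2 b) => x y z <- h2.
apply: (mulfI n0); rewrite mulrA [_ * (_ / _)]mulrC divfK// mulrDr h2.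
by rewrite -mulrDl -natrD; congr (_%:R * _); rewrite addSn addnS addnC.
Qed.

Lemma trig_int_cos a b : trig_int a b.+2 = b.+1%:R / (a + b).+2%:R * trig_int a b.
Proof.
have n0 : (a + b).+2%:R != 0 :> R by rewrite pnatr_eq0.
move: (trig_int_split a b) (trig_int_parts a b).
move: (trig_int a b) (trig_int a b.+2) (trig_int a.+2 b) => x y z <- h2.
apply: (mulfI n0); rewrite mulrA [_ * (_ / _)]mulrC divfK// mulrDr -h2.
by rewrite -mulrDl -natrD; congr (_%:R * _); rewrite addSn addnS addnC.
Qed.

Lemma trig_int1 b : trig_int 1 b = 0.
Proof.
rewrite /trig_int (@itg_FTC _ (fun x => - b.+1%:R^-1 * sc 0 b.+1 x))//.
- by rewrite /sc !cosN cos_pihalf expr0n /= !mulr0 subrr.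
- exact: continuous_sc.
- move=> x _; have := is_derive_sc 0 b.+1 x => h.
  have -> : (fun x => - b.+1%:R^-1 * sc 0 b.+1 x) = (- b.+1%:R^-1) *: sc 0 b.+1.
    by apply/funext => y; rewrite fctE.
  apply: is_derive_eq; rewrite /GRing.scale /= /sc.
  by field; rewrite nat1r pnatr_eq0.
Qed.

Lemma trig_int_odd a b : trig_int a.*2.+1 b = 0.
Proof. by elim: a => [|a IH]; rewrite ?trig_int1// doubleS trig_int_sin IH mulr0. Qed.

(** The Wallis integral. With [t = sin x], the density [cos x ^+ n / wallis n] is that of a
    coordinate on the unit sphere of R^(n+2). *)
Definition wallis n : R := trig_int 0 n.

Lemma wallis0 : wallis 0 = pi.
Proof.
rewrite /wallis /trig_int; have -> : sc 0 0 = (fun=> 1).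
  by apply/funext => x; rewrite /sc !expr0 mulr1.
rewrite itg_cst// /hp; lra.
Qed.

Lemma wallis1 : wallis 1 = 2.
Proof.
rewrite /wallis /trig_int (@itg_FTC _ sin)//.
- rewrite sinN /hp sin_pihalf; ring.
- exact: continuous_sc.
- by move=> x _; apply: is_derive_eq; rewrite /sc expr0 expr1 mul1r.
Qed.

Lemma wallis_ge0 n : 0 <= wallis n.
Proof.
have <- : itg (fun=> 0) (- hp) hp = 0 :> R by rewrite itg_cst// mul0r.
apply: le_itg => //; [exact: cst_continuous|exact: continuous_sc|].
move=> x /andP[h1 h2]; rewrite /sc expr0 mul1r exprn_ge0// cos_ge0_pihalf//.
by rewrite !ltW.
Qed.

Lemma wallis_decr n : wallis n.+1 <= wallis n.
Proof.
apply: le_itg => //; [exact: continuous_sc..|].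
move=> x /andP[h1 h2]; rewrite /sc expr0 !mul1r exprS ler_piMl ?cos_le1//.
by rewrite exprn_ge0// cos_ge0_pihalf// !ltW.
Qed.

(** The recurrence makes [n.+1%:R * wallis n * wallis n.+1] constant. With [wallis_decr] this bounds
    [wallis n] below with the sharp constant, without Stirling's formula. *)
Lemma wallis_mul n : wallis n * wallis n.+1 = 2 * pi / n.+1%:R.
Proof.
elim: n => [|n IH]; first by rewrite wallis0 wallis1 divr1 mulrC.
have -> : wallis n.+2 = n.+1%:R / n.+2%:R * wallis n by rewrite /wallis trig_int_cos add0n.
rewrite mulrCA [wallis n.+1 * _]mulrC IH; field.
by rewrite -?natrD ?nat1r !pnatr_eq0.
Qed.

Lemma wallis_gt0 n : 0 < wallis n.
Proof.
rewrite lt0r wallis_ge0 andbT; apply/eqP => h.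
have := wallis_mul n; rewrite h mul0r => /esym/eqP.
by rewrite !mulf_eq0 invr_eq0 !pnatr_eq0 /= orbF gt_eqF// pi_gt0.
Qed.

Lemma wallis_le_pi n : wallis n <= pi.
Proof. by elim: n => [|n IH]; rewrite ?wallis0// (le_trans (wallis_decr n)). Qed.

End Trigo.

(** * Sampling and moments *)

Section Sampling.
Variable R : realType.
Let hp : R := pi / 2.
Let hp4 : -4 < - hp. Proof. by have := @pihalf_lt2 R; rewrite /hp; lra. Qed.

Lemma continuousM_sc (f : R -> R) n : continuous f -> continuous (fun x => f x * sc 0 n x).
Proof. by move=> cf x; apply: cvgM; [exact: cf|exact: continuous_sc]. Qed.

Lemma sc0_ge0 n x : - hp < x < hp -> 0 <= sc 0 n x.
Proof.
move=> /andP[h1 h2]; rewrite /sc expr0 mul1r exprn_ge0// cos_ge0_pihalf//.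
by rewrite !ltW.
Qed.

Lemma itg_sc0_ge0 n (a b : R) : - hp <= a -> a <= b -> b <= hp -> 0 <= itg (sc 0 n) a b.
Proof.
move=> ha ab hb; have a4 := lt_le_trans hp4 ha.
have <- : itg (fun=> 0) a b = 0 :> R by rewrite itg_cst// mul0r.
apply: le_itg => //; [exact: cst_continuous|exact: continuous_sc|].
move=> x /andP[ax xb]; apply: sc0_ge0.
by rewrite (le_lt_trans ha)// (lt_le_trans xb).
Qed.

Lemma cell_error (f : R -> R) n (a b c : R) : continuous f ->
  - hp <= a -> a <= b -> b <= hp -> (forall x, a < x < b -> `|f x - f a| <= c) ->
  `|itg (fun x => f x * sc 0 n x) a b - f a * itg (sc 0 n) a b| <= c * itg (sc 0 n) a b.
Proof.
move=> cf ha ab hb hc; have a4 := lt_le_trans hp4 ha.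
have cs := @continuous_sc R 0 n.
rewrite ler_norml; apply/andP; split.
  rewrite lerBrDr -mulNr -mulrDl -itgZ//; apply: le_itg => //.
  - by move=> x; apply: cvgM; [exact: cvg_cst|exact: cs].
  - exact: continuousM_sc.
  - move=> x axb; move: (axb) => /andP[ax xb].
    rewrite ler_wpM2r ?sc0_ge0 ?(le_lt_trans ha) ?(lt_le_trans xb)//.
    by have := hc _ axb; rewrite ler_norml => /andP[]; lra.
rewrite lerBlDr -mulrDl -itgZ//; apply: le_itg => //.
- exact: continuousM_sc.
- by move=> x; apply: cvgM; [exact: cvg_cst|exact: cs].
- move=> x axb; move: (axb) => /andP[ax xb].
  rewrite ler_wpM2r ?sc0_ge0 ?(le_lt_trans ha) ?(lt_le_trans xb)//.
  by have := hc _ axb; rewrite ler_norml => /andP[]; lra.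
Qed.

(** The weights are the exact masses of equal cells, so the only error is the oscillation of [f]
    over a cell of length [pi / N]; hence one sample serves every [f] with the given Lipschitz
    constant. *)
Lemma angle_sample n (Lam eta : R) : 0 <= Lam -> 0 < eta ->
  exists N (w th : 'I_N -> R), [/\ forall i, 0 <= w i, \sum_i w i = 1 &
    forall f, continuous f ->
      (forall x y, `|f x - f y| <= Lam * `|x - y|) ->
      `|\sum_i w i * f (th i) - itg (fun x => f x * sc 0 n x) (- hp) hp / wallis R n| <= eta].
Proof.
move=> L0 e0.
pose N := (Num.truncn (Lam * pi / eta)).+1.
have N0 : 0 < N%:R :> R by rewrite ltr0n.
have LN : Lam * (pi / N%:R) <= eta.
  rewrite mulrA ler_pdivrMr// [leRHS]mulrC -ler_pdivrMr//.
  have q0 : 0 <= Lam * pi / eta by rewrite divr_ge0 ?mulr_ge0 ?pi_ge0 ?(ltW e0).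
  by have /andP[_ /ltW] := truncn_itv q0.
pose h : R := pi / N%:R; have h0 : 0 < h by rewrite divr_gt0// pi_gt0.
pose t (i : nat) : R := - hp + i%:R * h.
have tS i : t i.+1 = t i + h by rewrite /t -natr1; ring.
have t0 : t 0%N = - hp by rewrite /t mul0r addr0.
have tN : t N = hp by rewrite /t /h /hp; field; rewrite gt_eqF.
have tle i : t i <= t i.+1 by rewrite tS lerDl ltW.
have tlo i : - hp <= t i by rewrite /t lerDl mulr_ge0// ltW.
have thi i : (i < N)%N -> t i.+1 <= hp.
  by move=> iN; rewrite -tN /t lerD2l ler_wpM2r ?ler_nat// ltW.
have tel (g : R -> R) : \sum_(i < N) itg g (t i) (t i.+1) = itg g (- hp) hp.
  by rewrite -(big_mkord xpredT (fun i => itg g (t i) (t i.+1))) /itg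
    telescope_sumr// t0 tN.
pose w (i : 'I_N) := itg (sc 0 n) (t i) (t i.+1) / wallis R n.
have W0 := @wallis_gt0 R n.
exists N, w, (fun i => t i); split.
- by move=> i; apply: divr_ge0; [apply: itg_sc0_ge0 => //; exact: thi|exact: ltW].
- by rewrite /w -mulr_suml tel divff// gt_eqF.
move=> f cf lf.
rewrite -tel mulr_suml -sumrB.
apply: le_trans (ler_norm_sum _ _ _) _.
apply: (@le_trans _ _ (\sum_i eta * w i)); last first.
  by rewrite -mulr_sumr /w -mulr_suml tel divff ?mulr1// gt_eqF.
apply: ler_sum => i _; rewrite /w.
rewrite [_ / _ * f _]mulrAC -mulrBl normrM normfV (gtr0_norm W0) mulrA ler_pM2r ?invr_gt0//.
rewrite distrC [X in _ - X]mulrC; apply: cell_error => //; first exact: thi.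
move=> x /andP[ax xb]; apply: le_trans (lf _ _) _; apply: le_trans LN.
rewrite ler_wpM2l// ger0_norm ?subr_ge0 ?(ltW ax)//.
by rewrite lerBlDl -/h -tS ltW.
Qed.

Lemma sc_lipschitz a b (x y : R) : `|sc a b x - sc a b y| <= (a + b)%:R * `|x - y|.
Proof.
wlog xy : x y / x <= y.
  by move=> H; case: (leP x y) => [/H//|/ltW/H]; rewrite distrC [`|y - x|]distrC.
have d1 (z : R) : `|a%:R * sin z ^+ a.-1 * cos z ^+ b.+1
    - b%:R * sin z ^+ a.+1 * cos z ^+ b.-1| <= (a + b)%:R.
  have B m k : `|sin z ^+ m * cos z ^+ k| <= 1.
    by rewrite normrM !normrX mulr_ile1 ?exprn_ge0 ?exprn_ile1// ?sin_max ?cos_max.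
  apply: le_trans (ler_normB _ _) _; rewrite natrD -!mulrA.
  by apply: lerD; rewrite normrM normr_nat ler_piMr.
have dl (c z : R) : is_derive z 1 (c *: (id : R -> R)) c.
  by apply: is_derive_eq; rewrite /GRing.scale /= mulr1.
rewrite distrC [`|x - y|]distrC (@ger0_norm _ (y - x)) ?subr_ge0//.
rewrite ler_norml; apply/andP; split.
  have := @derive_le_diff R ((- (a + b)%:R) *: (id : R -> R)) (sc a b) (fun=> - (a + b)%:R)
     _ x y xy (fun z _ => dl _ z) (fun z _ => is_derive_sc a b z).
  rewrite !fctE /GRing.scale /= -mulrBr mulNr; apply => z _.
  by have := d1 z; rewrite ler_norml => /andP[].
have := @derive_le_diff R (sc a b) ((a + b)%:R *: (id : R -> R)) _ (fun=> (a + b)%:R)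
   x y xy (fun z _ => is_derive_sc a b z) (fun z _ => dl _ z).
rewrite !fctE /GRing.scale /= -mulrBr; apply => z _.
by have := d1 z; rewrite ler_norml => /andP[].
Qed.

End Sampling.

Section Moments.
Variable R : realType.

(* [cmom d k] is the moment of order 2k of a coordinate on the unit sphere of R^d. *)
Definition risep (m k : nat) : R := \prod_(l < k) (l.*2 + m)%:R.
Definition cmom (d k : nat) : R := risep 1 k / risep d k.

Lemma risepS m k : risep m k.+1 = risep m k * (k.*2 + m)%:R.
Proof. by rewrite /risep big_ord_recr. Qed.

Lemma risep_gt0 m k : (0 < m)%N -> 0 < risep m k.
Proof. by move=> m0; apply: prodr_gt0 => i _; rewrite ltr0n addn_gt0 m0 orbT. Qed.

Lemma risepD m i j : risep m (j + i) = risep m j * risep (j.*2 + m) i.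
Proof.
elim: i => [|i IH]; first by rewrite addn0 /risep big_ord0 mulr1.
by rewrite addnS !risepS IH -mulrA; congr (_ * (_ * _%:R)); rewrite doubleD -addnA addnCA.
Qed.

Lemma cmom01 d k : (0 < d)%N -> 0 <= cmom d k <= 1.
Proof.
move=> d0; have h1 := risep_gt0 k (ltn0Sn 0); have h2 := risep_gt0 k d0.
rewrite /cmom divr_ge0 ?(ltW h1) ?(ltW h2)//= ler_pdivrMr// mul1r.
by apply: ler_prod => l _; rewrite ler0n ler_nat leq_add2l.
Qed.

Lemma trig_int_even i b : trig_int R i.*2 b = wallis R b * (risep 1 i / risep b.+2 i).
Proof.
elim: i => [|i IH]; first by rewrite /risep !big_ord0 divr1 mulr1.
rewrite doubleS trig_int_sin IH !risepS -addn1 -2!addnS.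
have h := risep_gt0 i (ltn0Sn b.+1).
have B0 : 0 < (i.*2 + b.+2)%:R :> R by rewrite ltr0n addnS.
move: (risep 1 i) (risep b.+2 i) (i.*2 + 1)%:R (i.*2 + b.+2)%:R h B0 => p q r t h B0.
by field; rewrite !gt_eqF.
Qed.

Lemma wallis_even j n : wallis R (j.*2 + n) = wallis R n * (risep n.+1 j / risep n.+2 j).
Proof.
elim: j => [|j IH]; first by rewrite /risep !big_ord0 divr1 mulr1.
rewrite doubleS !addSn {1}/wallis trig_int_cos -/(wallis R _) IH !risepS add0n -2!addnS.
have h := risep_gt0 j (ltn0Sn n.+1).
have B0 : 0 < (j.*2 + n.+2)%:R :> R by rewrite ltr0n addnS.
move: (risep n.+1 j) (risep n.+2 j) (j.*2 + n.+1)%:R (j.*2 + n.+2)%:R h B0 => p q r t h B0.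
by field; rewrite !gt_eqF.
Qed.

Lemma fact_double k : (k.*2)`!%:R = 2 ^+ k * k`!%:R * risep 1 k :> R.
Proof.
elim: k => [|k IH]; first by rewrite /risep big_ord0 !mulr1.
rewrite doubleS !factS !natrM IH exprS risepS.
have -> : (k.*2.+2)%:R = 2 * k.+1%:R :> R by rewrite -natrM mul2n.
by rewrite addn1; ring.
Qed.

Lemma bin_double i j :
  'C((i + j).*2, j.*2)%:R * (risep 1 i * risep 1 j) = 'C(i + j, j)%:R * risep 1 (i + j) :> R.
Proof.
have h1 : 'C((i + j).*2, j.*2)%:R * ((j.*2)`!%:R * (i.*2)`!%:R) = ((i + j).*2)`!%:R :> R.
  by rewrite -!natrM -[in (i.*2)`!](addnK j.*2 i.*2) -doubleD bin_fact// leq_double leq_addl.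
have h2 : 'C(i + j, j)%:R * (j`!%:R * i`!%:R) = (i + j)`!%:R :> R.
  by rewrite -!natrM -[in i`!](addnK j i) bin_fact// leq_addl.
move: h1; rewrite !fact_double -h2 exprD.
have f0 m : m`!%:R != 0 :> R by rewrite pnatr_eq0 -lt0n fact_gt0.
have p0 m : 2 ^+ m != 0 :> R by rewrite expf_neq0// pnatr_eq0.
have c0 : 2 ^+ i * 2 ^+ j * (j`!%:R * i`!%:R) != 0 :> R by rewrite !mulf_neq0.
move=> h; apply: (mulfI c0); move: h.
set A := 'C(_, j.*2)%:R; set B := 'C(_, _)%:R => h.
by rewrite [RHS]mulrC; apply: etrans (etrans h _); ring.
Qed.

(* This is the identity behind the rotation invariance of the construction:
   the moments of sin and cos match the binomial expansion. *)
Lemma moment_ident n i j :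
  'C((i + j).*2, j.*2)%:R * (trig_int R i.*2 (j.*2 + n) / wallis R n) * cmom n.+1 j =
  cmom n.+2 (i + j) * 'C(i + j, j)%:R.
Proof.
rewrite trig_int_even wallis_even /cmom (addnC i j) (risepD n.+2) (addnC j i).
have -> : (j.*2 + n).+2 = (j.*2 + n.+2)%N by rewrite !addnS.
have h1 := risep_gt0 j (ltn0Sn n); have h2 := risep_gt0 j (ltn0Sn n.+1).
have h3 : 0 < risep (j.*2 + n.+2) i by rewrite risep_gt0// addnS.
have h4 := wallis_gt0 R n; have := bin_double i j.
move: (risep n.+1 j) (risep n.+2 j) (risep (j.*2 + n.+2) i) (wallis R n) h1 h2 h3 h4.
move: (risep 1 i) (risep 1 j) (risep 1 (i + j)) 'C((i + j).*2, j.*2)%:R 'C(i + j, j)%:R.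
move=> a b c B C p q r w p0 q0 r0 w0 h.
transitivity (B * (a * b) / (q * r)); first by field; rewrite !gt_eqF.
by rewrite h; field; rewrite !gt_eqF.
Qed.

Lemma sum_even_odd k (F : nat -> R) : (forall j, F j.*2.+1 = 0) ->
  \sum_(i < k.*2.+1) F i = \sum_(j < k.+1) F j.*2.
Proof.
move=> F0; elim: k => [|k IH]; first by rewrite !big_ord1.
by rewrite doubleS 2!big_ord_recr IH /= F0 addr0 [RHS]big_ord_recr.
Qed.

End Moments.

(** * Point systems with prescribed moments *)

Section Design.
Variable R : realType.

Definition unit_system (d : nat) (V : finType) (w : V -> R) (u : V -> nat -> R) :=
  [/\ forall v, 0 <= w v, \sum_v w v = 1 & forall v, dot d (u v) (u v) = 1].

(** The vector [x] ranges over the whole ball because the induction truncates it to fewer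
    coordinates. Odd moments vanish exactly, so only even ones carry an error. *)
Definition moment_approx d K (eta : R) (V : finType) (w : V -> R) (u : V -> nat -> R) :=
  forall x, dot d x x <= 1 ->
    (forall k, \sum_v w v * dot d (u v) x ^+ k.*2.+1 = 0) /\
    (forall k, (k <= K)%N ->
      `|\sum_v w v * dot d (u v) x ^+ k.*2 - cmom R d k * dot d x x ^+ k| <= eta).

Lemma sign_odd (b : bool) k : ((-1) ^+ b) ^+ k.*2.+1 = (-1) ^+ b :> R.
Proof. by rewrite -exprM -signr_odd oddM /= odd_double oddb andbT. Qed.

Lemma sign_even (b : bool) k : ((-1) ^+ b) ^+ k.*2 = 1 :> R.
Proof. by rewrite -exprM -signr_odd oddM odd_double andbF. Qed.

Lemma moment_design1 K (eta : R) : 0 < eta ->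
  exists (V : finType) (w : V -> R) (u : V -> nat -> R),
    unit_system 1 w u /\ moment_approx 1 K eta w u.
Proof.
move=> e0; exists bool, (fun=> 1 / 2), (fun (b : bool) _ => (-1) ^+ b).
have dE b (x : nat -> R) : dot 1 (fun=> (-1) ^+ (b : bool)) x = (-1) ^+ b * x 0%N.
  by rewrite /dot big_ord1.
split; first split.
- by move=> v; rewrite divr_ge0.
- by rewrite big_bool /=; lra.
- by move=> b; rewrite dE -expr2 -[2%N]/(1.*2) sign_even.
move=> x _; split=> [k|k _].
  by rewrite big_bool (dE true) (dE false) !exprMn !sign_odd /= expr0 expr1; ring.
rewrite big_bool (dE true) (dE false) !exprMn !sign_even !mul1r.
rewrite /cmom divff ?gt_eqF ?risep_gt0// /dot big_ord1 -expr2 -exprM mul2n.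
have -> : forall a : R, 2^-1 * a + 2^-1 * a - 1 * a = 0 by move=> a; field.
by rewrite normr0 ltW.
Qed.

Lemma dotS d (x y : nat -> R) : dot d.+1 x y = dot d x y + x d * y d.
Proof. by rewrite /dot big_ord_recr. Qed.

Lemma eq_dot d (x x' y : nat -> R) : (forall i, (i < d)%N -> x i = x' i) ->
  dot d x y = dot d x' y.
Proof. by move=> h; apply: eq_bigr => i _; rewrite h. Qed.

Lemma prod_approx (a b s t eta : R) : `|a| <= 1 -> `|t| <= 1 ->
  `|a - s| <= eta -> `|b - t| <= eta -> `|a * b - s * t| <= eta + eta.
Proof.
move=> a1 t1 h1 h2.
have -> : a * b - s * t = a * (b - t) + (a - s) * t by ring.
apply: le_trans (ler_normD _ _) _; rewrite !normrM; apply: lerD.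
  by apply: le_trans h2; rewrite ler_piMl.
by apply: le_trans h1; rewrite ler_piMr.
Qed.

Lemma mean_norm_le1 (V : finType) (w f : V -> R) : (forall v, 0 <= w v) ->
  \sum_v w v = 1 -> (forall v, `|f v| <= 1) -> `|\sum_v w v * f v| <= 1.
Proof.
move=> w0 w1 f1; apply: le_trans (ler_norm_sum _ _ _) _.
rewrite -w1; apply: ler_sum => v _.
by rewrite normrM (ger0_norm (w0 v)) ler_piMr.
Qed.

Section Step.
Variables (n K : nat) (eta eta1 : R).
Variables (V : finType) (w : V -> R) (u : V -> nat -> R).
Variables (N : nat) (wt th : 'I_N -> R).
Hypothesis us : unit_system n.+1 w u.
Hypothesis ma : moment_approx n.+1 K eta1 w u.
Hypothesis wt_ge0 : forall i, 0 <= wt i.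
Hypothesis wt_sum : \sum_i wt i = 1.
Hypothesis ht : forall i j, (i + j <= K)%N ->
  `|\sum_t wt t * sc i.*2 j.*2 (th t) - trig_int R i.*2 (j.*2 + n) / wallis R n| <= eta1.

Let V' : finType := ('I_N * V * bool)%type.
Let w' (p : V') := wt p.1.1 * w p.1.2 * (1 / 2).
(** A point of latitude [th p.1.1] over a point of the smaller sphere. The sign restores the central
    symmetry that the sample of angles lacks, which makes odd moments vanish exactly. *)
Let u' (p : V') (i : nat) : R :=
  (-1) ^+ p.2 * (if i == n.+1 then sin (th p.1.1) else cos (th p.1.1) * u p.1.2 i).

Lemma sum_triple (F : 'I_N -> V -> bool -> R) :
  \sum_(p : V') F p.1.1 p.1.2 p.2 = \sum_t \sum_v (F t v true + F t v false).
Proof.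
rewrite -(pair_bigA _ (fun q b => F q.1 q.2 b)) /=.
rewrite -(pair_bigA _ (fun t v => \sum_b F t v b)) /=.
by apply: eq_bigr => t _; apply: eq_bigr => v _; rewrite big_bool.
Qed.

Lemma step_dot p x : dot n.+2 (u' p) x =
  (-1) ^+ p.2 * (sin (th p.1.1) * x n.+1 + cos (th p.1.1) * dot n.+1 (u p.1.2) x).
Proof.
rewrite dotS.
rewrite (@eq_dot n.+1 _ (fun i => (-1) ^+ p.2 * (cos (th p.1.1) * u p.1.2 i))).
  by rewrite /u' eqxx !dotZl; ring.
by move=> i iN; rewrite /u' ltn_eqF.
Qed.

Lemma step_unit : unit_system n.+2 w' u'.
Proof.
have [w0 w1 u1] := us; split.
- by move=> p; rewrite !mulr_ge0// divr_ge0.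
- rewrite (sum_triple (fun t v _ => wt t * w v * (1 / 2))).
  rewrite -[RHS]wt_sum; apply: eq_bigr => t _.
  transitivity (wt t * \sum_v w v); last by rewrite w1 mulr1.
  by rewrite mulr_sumr; apply: eq_bigr => v _ /=; field.
- move=> p; rewrite step_dot /u' eqxx.
  rewrite (dotC _ (u p.1.2)).
  rewrite (@eq_dot n.+1 _ (fun i => (-1) ^+ p.2 * (cos (th p.1.1) * u p.1.2 i))).
    rewrite !dotZl u1 -[RHS](cos2Dsin2 (th p.1.1)).
    have s1 : (-1) ^+ p.2 * (-1) ^+ p.2 = 1 :> R.
      by rewrite -expr2 -[2%N]/(1.*2) sign_even.
    move: ((-1) ^+ p.2) s1 => e s1.
    transitivity (e * e * (cos (th p.1.1) ^+ 2 + sin (th p.1.1) ^+ 2)); first by ring.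
    by rewrite s1 mul1r.
  by move=> i iN; rewrite /u' ltn_eqF.
Qed.

Lemma step_odd x k : \sum_p w' p * dot n.+2 (u' p) x ^+ k.*2.+1 = 0.
Proof.
under eq_bigr do rewrite step_dot.
rewrite (sum_triple (fun t v b => wt t * w v * (1 / 2) *
  ((-1) ^+ b * (sin (th t) * x n.+1 + cos (th t) * dot n.+1 (u v) x)) ^+ k.*2.+1)).
apply: big1 => t _; apply: big1 => v _; cbv beta.
by rewrite !exprMn !sign_odd /= expr0 expr1; ring.
Qed.

(** The angle and the point of the smaller sphere are independent, so each term of the binomial
    expansion factors; the terms with an odd moment of [u] vanish. *)
Lemma step_even x k : dot n.+2 x x <= 1 ->
  \sum_p w' p * dot n.+2 (u' p) x ^+ k.*2 =
  \sum_(j < k.+1) 'C(k.*2, j.*2)%:R * (x n.+1 ^+ 2) ^+ (k - j) *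
    ((\sum_t wt t * sc (k - j).*2 j.*2 (th t)) *
     (\sum_v w v * dot n.+1 (u v) x ^+ j.*2)).
Proof.
move=> x1; under eq_bigr do rewrite step_dot.
rewrite (sum_triple (fun t v b => wt t * w v * (1 / 2) *
  ((-1) ^+ b * (sin (th t) * x n.+1 + cos (th t) * dot n.+1 (u v) x)) ^+ k.*2)).
have xn : dot n.+1 x x <= 1.
  by apply: le_trans x1; rewrite [leRHS]dotS lerDl -expr2 sqr_ge0.
have [odd0 _] := ma xn.
pose F i := 'C(k.*2, i)%:R * x n.+1 ^+ (k.*2 - i) *
   ((\sum_t wt t * (sin (th t) ^+ (k.*2 - i) * cos (th t) ^+ i)) *
    (\sum_v w v * dot n.+1 (u v) x ^+ i)).
transitivity (\sum_(i < k.*2.+1) F i); last first.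
  rewrite (@sum_even_odd R k F); last by move=> j; rewrite /F odd0 !mulr0.
  apply: eq_bigr => j _; rewrite /F -doubleB -exprM mul2n; congr (_ * _).
transitivity (\sum_t \sum_v \sum_(i < k.*2.+1) 'C(k.*2, i)%:R * x n.+1 ^+ (k.*2 - i) *
   ((wt t * (sin (th t) ^+ (k.*2 - i) * cos (th t) ^+ i)) *
    (w v * dot n.+1 (u v) x ^+ i))).
  apply: eq_bigr => t _; apply: eq_bigr => v _.
  rewrite !exprMn !sign_even !mul1r.
  have -> : forall a b : R, a / 2 * b + a / 2 * b = a * b by move=> a b; field.
  rewrite exprDn mulr_sumr.
  by apply: eq_bigr => i _; rewrite !exprMn -mulr_natr; ring.
under eq_bigr do rewrite exchange_big.
rewrite exchange_big; apply: eq_bigr => i _ /=.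
rewrite /F mulr_suml mulr_sumr; apply: eq_bigr => t _.
by rewrite !mulr_sumr; apply: eq_bigr => v _.
Qed.

(** By [moment_ident], the binomial expansion in the last coordinate gives term by term the exact
    counterpart of [step_even]. *)
Lemma step_main x k : dot n.+2 x x <= 1 ->
  cmom R n.+2 k * dot n.+2 x x ^+ k =
  \sum_(j < k.+1) 'C(k.*2, j.*2)%:R * (x n.+1 ^+ 2) ^+ (k - j) *
    (trig_int R (k - j).*2 (j.*2 + n) / wallis R n * (cmom R n.+1 j * dot n.+1 x x ^+ j)).
Proof.
move=> x1; rewrite dotS addrC exprDn mulr_sumr; apply: eq_bigr => j _.
have jk : (j <= k)%N by rewrite -ltnS.
have := moment_ident R n (k - j) j; rewrite subnK// => E.
rewrite -mulr_natr -expr2.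
transitivity (cmom R n.+2 k * 'C(k, j)%:R * ((x n.+1 ^+ 2) ^+ (k - j) * dot n.+1 x x ^+ j)).
  by ring.
by rewrite -E; ring.
Qed.

Lemma step_approx : 0 <= eta1 ->
  (\sum_(k < K.+1) \sum_(j < k.+1) 'C(k.*2, j.*2)%:R) * (eta1 + eta1) <= eta ->
  moment_approx n.+2 K eta w' u'.
Proof.
move=> e0 he x x1; split; first exact: step_odd.
move=> k kK; rewrite step_even// step_main// -sumrB.
have [w0 w1 u1] := us.
have q1 : dot n.+1 x x <= 1.
  by apply: le_trans x1; rewrite [leRHS]dotS lerDl -expr2 sqr_ge0.
have a1 : x n.+1 ^+ 2 <= 1.
  by apply: le_trans x1; rewrite [leRHS]dotS -expr2 lerDr dot_ge0.
have [_ ev] := ma q1.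
apply: le_trans (ler_norm_sum _ _ _) _; apply: le_trans he.
apply: (@le_trans _ _ ((\sum_(j < k.+1) 'C(k.*2, j.*2)%:R) * (eta1 + eta1))); last first.
  rewrite ler_wpM2r ?addr_ge0//.
  rewrite [leRHS](bigD1 (inord k : 'I_K.+1)) //= inordK ?ltnS// lerDl.
  by apply: sumr_ge0 => i _; apply: sumr_ge0.
rewrite mulr_suml; apply: ler_sum => j _; have jk : (j <= k)%N by rewrite -ltnS.
rewrite -mulrBr normrM.
apply: ler_pM => //.
  rewrite normrM normr_nat ler_piMr// ger0_norm; last first.
    by apply: exprn_ge0; exact: sqr_ge0.
  by apply: exprn_ile1 => //; exact: sqr_ge0.
apply: prod_approx.
- apply: mean_norm_le1 => // t; rewrite /sc normrM !normrX.
  by rewrite mulr_ile1 ?exprn_ge0 ?exprn_ile1// ?sin_max ?cos_max.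
- have /andP[c0 c1] := cmom01 R j (ltn0Sn n).
  have p0 : 0 <= dot n.+1 x x ^+ j by apply: exprn_ge0; exact: dot_ge0.
  rewrite ger0_norm; last by apply: mulr_ge0.
  by apply: mulr_ile1 => //; apply: exprn_ile1 => //; exact: dot_ge0.
- by apply: ht; rewrite subnK.
- by apply: ev; exact: leq_trans kK.
Qed.

End Step.

Theorem moment_design n K (eta : R) : 0 < eta ->
  exists (V : finType) (w : V -> R) (u : V -> nat -> R),
    unit_system n.+1 w u /\ moment_approx n.+1 K eta w u.
Proof.
elim: n eta => [|n IH] eta e0; first exact: moment_design1.
pose C : R := \sum_(k < K.+1) \sum_(j < k.+1) 'C(k.*2, j.*2)%:R.
have C0 : 0 <= C by apply: sumr_ge0 => i _; apply: sumr_ge0.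
(* Each product of two approximate moments is off by at most [2 * eta1], and [C] is the total of the
   binomial coefficients in front. *)
pose eta1 := eta / (2 * (C + 1)).
have C1 : 0 < 2 * (C + 1) by rewrite mulr_gt0// ltr_wpDl.
have e1 : 0 < eta1 by rewrite divr_gt0.
have [V [w [u [us ma]]]] := IH _ e1.
have [N [wt [th [wt0 wt1 hw]]]] := @angle_sample R n (K.*2)%:R eta1 (ler0n _ _) e1.
have U := @step_unit _ _ _ _ _ _ th us wt0 wt1.
eexists _, _, _; split; first exact: U.
apply: (step_approx us ma wt0 wt1); [|exact: ltW|]; last first.
  rewrite -/C /eta1.
  have -> : C * (eta / (2 * (C + 1)) + eta / (2 * (C + 1))) = eta * (C / (C + 1)).
    by field; move: C1; rewrite pmulr_rgt0// => /gt_eqF ->.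
  by rewrite ler_piMr ?(ltW e0)// ler_pdivrMr ?mul1r ?lerDl// ltr_wpDl.
move=> i j ij; have := hw (sc i.*2 j.*2) (@continuous_sc R _ _).
have -> : itg (fun x => sc i.*2 j.*2 x * sc 0 n x) (- (pi / 2)) (pi / 2) =
    trig_int R i.*2 (j.*2 + n).
  by congr (itg _ _ _); apply/funext => x; rewrite /sc expr0 exprD; ring.
apply => x y; apply: le_trans (sc_lipschitz _ _ _ _) _.
by rewrite ler_wpM2r// ler_nat -doubleD leq_double.
Qed.

End Design.

(** * Point systems for Lipschitz functions *)

Section Bernstein.
Variable R : realType.
Implicit Types (f g : nat -> R) (t : R).

(* Bernstein polynomials on [-1, 1]: [bern n f] evaluates at t to the expectation of
   f at a binomial variable with parameters n and (1 + t) / 2. *)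
Fixpoint bern n f : {poly R} :=
  if n is n'.+1 then
    2^-1 *: ((bern n' (fun k => f k.+1) + 'X * bern n' (fun k => f k.+1)) +
             (bern n' f - 'X * bern n' f))
  else (f 0%N)%:P.

Lemma horner_bernS n f t : (bern n.+1 f).[t] =
  (1 + t) / 2 * (bern n (fun k => f k.+1)).[t] + (1 - t) / 2 * (bern n f).[t].
Proof. by rewrite /= hornerZ !hornerD hornerN !hornerM hornerX; field. Qed.

Lemma bern_le n f g t : -1 <= t <= 1 -> (forall k, (k <= n)%N -> f k <= g k) ->
  (bern n f).[t] <= (bern n g).[t].
Proof.
move=> t1; elim: n f g => [|n IH] f g fg; first by rewrite /= !hornerC fg.
rewrite !horner_bernS; apply: lerD; apply: ler_wpM2l; try lra; apply: IH => k kn.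
  exact: fg.
by apply: fg; exact: leqW.
Qed.

Lemma bern_affine n f t a b :
  (bern n (fun k => a * f k + b)).[t] = a * (bern n f).[t] + b.
Proof.
elim: n f => [|n IH] f; first by rewrite /= !hornerC.
by rewrite !horner_bernS !IH; field.
Qed.

(** The second moment of a shifted binomial variable: its variance plus the square of its mean. *)
Lemma bern_sqr n t a : (bern n (fun k => (k%:R + a) ^+ 2)).[t] =
  n%:R * ((1 + t) / 2 * ((1 - t) / 2)) + (n%:R * ((1 + t) / 2) + a) ^+ 2.
Proof.
elim: n a => [|n IH] a; first by rewrite /= hornerC !mul0r !add0r.
rewrite horner_bernS.
have -> : (fun k => (k.+1%:R + a) ^+ 2) = (fun k => (k%:R + (1 + a)) ^+ 2).
  by apply/funext => k; rewrite -natr1 addrA.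
by rewrite !IH -natr1; field.
Qed.

(** The bound [|s - t| <= (s - t)^2 / (2 e) + e / 2] replaces [phi] by a quadratic majorant, whose
    Bernstein polynomial is known from the variance; [1 <= e ^+ 2 * n.+1%:R] makes the quadratic
    part at most [e / 2]. *)
Lemma bern_upper n (phi : R -> R) (Lam e t : R) : 0 <= Lam -> 0 < e -> -1 <= t <= 1 ->
  (forall s t, -1 <= s <= 1 -> -1 <= t <= 1 -> `|phi s - phi t| <= Lam * `|s - t|) ->
  1 <= e ^+ 2 * n.+1%:R ->
  (bern n.+1 (fun k => phi (2 * k%:R / n.+1%:R - 1))).[t] <= phi t + Lam * e.
Proof.
move=> L0 e0 t1 lip he; set N : R := n.+1%:R.
have N0 : 0 < N by rewrite ltr0n.
pose A := Lam * (2 / (e * N ^+ 2)).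
pose a : R := - (N * ((1 + t) / 2)).
apply: (@le_trans _ _ (bern n.+1 (fun k => A * (k%:R + a) ^+ 2 + (phi t + Lam * (e / 2)))).[t]).
  apply: bern_le => // k kn.
  set s := 2 * k%:R / N - 1.
  have s1 : -1 <= s <= 1.
    have k0 : 0 <= k%:R / N by rewrite divr_ge0// ltW.
    have k1 : k%:R / N <= 1 by rewrite ler_pdivrMr// mul1r ler_nat.
    by rewrite /s -mulrA; move: (k%:R / N) k0 k1 => q; lra.
  have h := lip s t s1 t1.
  have h2 : `|s - t| <= 2 / (e * N ^+ 2) * (k%:R + a) ^+ 2 + e / 2.
    have -> : 2 / (e * N ^+ 2) * (k%:R + a) ^+ 2 = (s - t) ^+ 2 / (2 * e).
      by rewrite /s /a; field; rewrite !gt_eqF.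
    rewrite -(real_normK (num_real (s - t))); move: `|s - t| => y.
    have -> : y ^+ 2 / (2 * e) + e / 2 = (y ^+ 2 + e ^+ 2) / (2 * e).
      by field; rewrite gt_eqF.
    rewrite ler_pdivlMr ?mulr_gt0//; have := sqr_ge0 (y - e); lra.
  have h3 := ler_wpM2l L0 h2.
  have := ler_norm (phi s - phi t); rewrite /A -mulrA; move: h h3.
  by move: (2 / _ * _) => q; lra.
rewrite (bern_affine _ (fun k => (k%:R + a) ^+ 2)) bern_sqr -/N /a subrr expr0n addr0.
rewrite addrCA lerD2l.
have -> : A * (N * ((1 + t) / 2 * ((1 - t) / 2))) + Lam * (e / 2) =
   Lam * ((1 - t ^+ 2) / (2 * e * N) + e / 2).
  by rewrite /A; field; rewrite !gt_eqF.
rewrite ler_wpM2l//.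
suff h : (1 - t ^+ 2) / (2 * e * N) <= e / 2.
  by apply: le_trans (lerD h (lexx _)) _; lra.
rewrite ler_pdivrMr ?mulr_gt0//.
have -> : e / 2 * (2 * e * N) = e ^+ 2 * N by field.
by apply: le_trans he; rewrite gerBl sqr_ge0.
Qed.

Lemma bern_approx n (phi : R -> R) (Lam e t : R) : 0 <= Lam -> 0 < e -> -1 <= t <= 1 ->
  (forall s t, -1 <= s <= 1 -> -1 <= t <= 1 -> `|phi s - phi t| <= Lam * `|s - t|) ->
  1 <= e ^+ 2 * n.+1%:R ->
  `|(bern n.+1 (fun k => phi (2 * k%:R / n.+1%:R - 1))).[t] - phi t| <= Lam * e.
Proof.
move=> L0 e0 t1 lip he; rewrite ler_norml; apply/andP; split; last first.
  by rewrite lerBlDl; exact: bern_upper.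
have lipN s r : -1 <= s <= 1 -> -1 <= r <= 1 ->
    `|- phi s - (- phi r)| <= Lam * `|s - r|.
  by move=> hs hr; rewrite -opprD normrN; exact: lip.
have := @bern_upper n (fun s => - phi s) Lam e t L0 e0 t1 lipN he.
have -> : (fun k => - phi (2 * k%:R / n.+1%:R - 1)) =
    (fun k => (-1) * phi (2 * k%:R / n.+1%:R - 1) + 0).
  by apply/funext => k; rewrite mulN1r addr0.
rewrite (bern_affine _ (fun k => phi (2 * k%:R / n.+1%:R - 1))).
by lra.
Qed.

Lemma size_bern n f : (size (bern n f) <= n.+1)%N.
Proof.
elim: n f => [|n IH] f /=; first exact: size_polyC_leq1.
apply: leq_trans (size_scale_leq _ _) _.
have h g : (size ('X * bern n g)%R <= n.+2)%N.
  by apply: leq_trans (size_polyMleq _ _) _; rewrite size_polyX addSn add1n /= ltnS.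
have h' g : (size (bern n g) <= n.+2)%N by apply: leq_trans (IH g) _.
apply: leq_trans (size_polyD _ _) _; rewrite geq_max; apply/andP; split.
  by apply: leq_trans (size_polyD _ _) _; rewrite geq_max h h'.
by apply: leq_trans (size_polyD _ _) _; rewrite geq_max size_polyN h h'.
Qed.

(** Each recursion step halves a signed sum of four coefficients, so the bound doubles. It depends
    on [f] only through [B], which lets one moment system serve all functions. *)
Lemma coef_bern n f (B : R) j : (forall k, (k <= n)%N -> `|f k| <= B) ->
  `|(bern n f)`_j| <= 2 ^+ n * B.
Proof.
elim: n f j => [|n IH] f j fB.
  rewrite /= coefC expr0 mul1r; case: ifP => _; first exact: fB.
  by rewrite normr0; exact: le_trans (fB _ (leqnn 0)).
have B0 : 0 <= B by exact: le_trans (fB _ (leq0n _)).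
have h1 i : `|(bern n (fun k => f k.+1))`_i| <= 2 ^+ n * B by apply: IH => k kn; exact: fB.
have h2 i : `|(bern n f)`_i| <= 2 ^+ n * B by apply: IH => k kn; apply: fB; exact: leqW.
have X g i : (forall i, `|(bern n g)`_i| <= 2 ^+ n * B) -> `|('X * bern n g)`_i| <= 2 ^+ n * B.
  by move=> h; rewrite coefXM; case: ifP => // _; rewrite normr0 mulr_ge0.
rewrite /= coefZ coefD coefD coefB.
have := h1 j; have := h2 j; have := X _ j h1; have := X _ j h2.
rewrite exprS -mulrA; move: (2 ^+ n * B) => c.
move: (bern _ _)`_j ('X * _)`_j (bern _ _)`_j ('X * _)`_j => p q r s.
by rewrite !ler_norml; lra.
Qed.

End Bernstein.

Section LipschitzDesign.
Variable R : realType.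
Let hp : R := pi / 2.
Let hp4 : -4 < - hp. Proof. by have := @pihalf_lt2 R; rewrite /hp; lra. Qed.
Let hple : - hp <= hp. Proof. by have := @pihalf_ge1 R; rewrite /hp; lra. Qed.

Definition lipschitz_on_segment (Lam : R) (phi : R -> R) :=
  forall s t, -1 <= s <= 1 -> -1 <= t <= 1 -> `|phi s - phi t| <= Lam * `|s - t|.

(* The mean of [phi] over the first coordinate of the sphere of R^(n+2). *)
Definition zonal_mean n (phi : R -> R) : R :=
  itg (fun x => phi (sin x) * sc 0 n x) (- hp) hp / wallis R n.

Lemma sin_segment (x : R) : -1 <= sin x <= 1.
Proof. by rewrite sin_geN1 sin_le1. Qed.

Lemma lipschitz_continuous (Lam : R) (g : R -> R) :
  (forall x y, `|g x - g y| <= Lam * `|x - y|) -> continuous g.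
Proof.
move=> lip x; apply/cvgrPdist_le => /= e e0.
pose L := `|Lam| + 1; have L0 : 0 < L by rewrite ltr_wpDl.
near=> y; apply: le_trans (lip x y) _.
apply: (@le_trans _ _ (L * `|x - y|)).
  by rewrite ler_wpM2r// (le_trans (ler_norm Lam))// lerDl.
rewrite -ler_pdivlMl// mulrC; near: y.
apply: (@cvgr_dist_le _ _ _ _ (nbhs_filter x) id x _ (e / L)); first exact: cvg_id.
by rewrite divr_gt0.
Unshelve. all: by end_near. Qed.

Lemma continuous_sin_comp (Lam : R) (phi : R -> R) : 0 <= Lam -> lipschitz_on_segment Lam phi ->
  continuous (fun x => phi (sin x)).
Proof.
move=> L0 lip; apply: (@lipschitz_continuous Lam) => x y.
apply: le_trans (lip _ _ (sin_segment x) (sin_segment y)) _.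
rewrite ler_wpM2l//; have := sc_lipschitz 1 0 x y.
by rewrite /sc !expr1 !expr0 !mulr1 mul1r.
Qed.

Lemma zonal_mean_le n (phi psi : R -> R) : continuous (fun x => phi (sin x)) ->
  continuous (fun x => psi (sin x)) -> (forall t, -1 <= t <= 1 -> phi t <= psi t) ->
  zonal_mean n phi <= zonal_mean n psi.
Proof.
move=> c1 c2 h; rewrite /zonal_mean ler_pM2r ?invr_gt0 ?wallis_gt0//.
apply: le_itg => //; [exact: continuousM_sc..|move=> x xh].
by rewrite ler_wpM2r ?sc0_ge0// h// sin_segment.
Qed.

Lemma zonal_mean_affine n (phi : R -> R) (a b : R) : continuous (fun x => phi (sin x)) ->
  zonal_mean n (fun t => a * phi t + b) = a * zonal_mean n phi + b.
Proof.
move=> c; rewrite /zonal_mean.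
have -> : (fun x => (a * phi (sin x) + b) * sc 0 n x) =
   (fun x => a * (phi (sin x) * sc 0 n x) + b * sc 0 n x).
  by apply/funext => x; ring.
have c' := @continuousM_sc R _ n c; have cs := @continuous_sc R 0 n.
have c1 : continuous (fun x => a * (phi (sin x) * sc 0 n x)).
  by move=> x; apply: cvgM; [exact: cvg_cst|exact: c'].
have c2 : continuous (fun x => b * sc 0 n x).
  by move=> x; apply: cvgM; [exact: cvg_cst|exact: cs].
rewrite (itgD c1 c2 hp4 hple) (itgZ a c' hp4 hple) (itgZ b cs hp4 hple) mulrDl -mulrA.
congr (_ + _).
by rewrite -/hp -[itg (sc 0 n) _ _]/(wallis R n) mulfK// gt_eqF// wallis_gt0.
Qed.

Lemma continuous_horner_sin (p : {poly R}) : continuous (fun x => p.[sin x]).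
Proof.
move=> x; apply: (@continuous_comp _ _ _ (@sin R) (fun y => p.[y])).
  exact: continuous_sin.
exact: continuous_horner.
Qed.

Lemma zonal_mean_poly n m (p : {poly R}) : (size p <= m)%N ->
  zonal_mean n (fun t => p.[t]) = \sum_(j < m) p`_j * (trig_int R j n / wallis R n).
Proof.
move=> sp; rewrite /zonal_mean.
have -> : (fun x => p.[sin x] * sc 0 n x) = (fun x => \sum_(j < m) p`_j * sc j n x).
  apply/funext => x; rewrite (horner_coef_wide _ sp) mulr_suml.
  by apply: eq_bigr => j _; rewrite /sc expr0 mul1r mulrA.
rewrite itg_sum//; last first.
  by move=> j x; apply: cvgM; [exact: cvg_cst|exact: continuous_sc].
rewrite mulr_suml; apply: eq_bigr => j _; rewrite itgZ//; last exact: continuous_sc.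
by rewrite mulrA.
Qed.

Lemma moment_full n K (eta : R) (V : finType) (w : V -> R) (u : V -> nat -> R) x j :
  0 <= eta -> moment_approx n.+2 K eta w u -> dot n.+2 x x = 1 -> (j <= K)%N ->
  `|\sum_v w v * dot n.+2 (u v) x ^+ j - trig_int R j n / wallis R n| <= eta.
Proof.
move=> e0 ma x1 jK; have := ma x; rewrite x1 lexx => /(_ isT) [odd0 ev].
rewrite -(odd_double_half j); case: (odd j); rewrite ?add1n ?add0n.
  by rewrite odd0 trig_int_odd mul0r subrr normr0.
rewrite trig_int_even [wallis R n * _]mulrC mulfK ?gt_eqF ?wallis_gt0//.
have := ev j./2; rewrite expr1n mulr1; apply.
by apply: leq_trans jK; rewrite leq_half_double -addnn ltnW// ltnS leq_addr.
Qed.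

(** The system must be chosen before [phi]: degree and coefficient bound depend on [Lam] only. Three
    quarters of [eta] are spent, on Bernstein approximation over the system, on the moments, and on
    Bernstein approximation over the sphere. *)
Theorem lipschitz_design n (Lam eta : R) : 0 <= Lam -> 0 < eta ->
  exists (V : finType) (w : V -> R) (u : V -> nat -> R), unit_system n.+2 w u /\
    forall phi, lipschitz_on_segment Lam phi -> forall x, dot n.+2 x x = 1 ->
      `|\sum_v w v * phi (dot n.+2 (u v) x) - zonal_mean n phi| <= eta.
Proof.
move=> L0 eta0.
pose e := eta / (4 * (Lam + 1)).
have L1 : 0 < 4 * (Lam + 1) by rewrite mulr_gt0// ltr_wpDl.
have e0 : 0 < e by rewrite divr_gt0.
pose N := Num.truncn (1 / e ^+ 2).
have hN : 1 <= e ^+ 2 * N.+1%:R.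
  rewrite -ler_pdivrMl ?exprn_gt0// mulrC.
  have q0 : 0 <= 1 / e ^+ 2 by rewrite divr_ge0 ?sqr_ge0.
  by have /andP[_ /ltW] := truncn_itv q0.
have Le : Lam * e <= eta / 4.
  have -> : Lam * e = eta / 4 * (Lam / (Lam + 1)).
    by rewrite /e; field; move: L1; rewrite pmulr_rgt0// => /gt_eqF ->.
  rewrite ler_piMr ?divr_ge0 ?(ltW eta0)// ler_pdivrMr ?mul1r ?lerDl//.
  by rewrite ltr_wpDl.
pose C : R := N.+2%:R * (2 ^+ N.+1 * Lam).
have C0 : 0 <= C by rewrite !mulr_ge0 ?exprn_ge0.
pose eta1 := eta / (4 * (C + 1)).
have C1 : 0 < 4 * (C + 1) by rewrite mulr_gt0// ltr_wpDl.
have e1 : 0 < eta1 by rewrite divr_gt0.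
have CE : C * eta1 <= eta / 4.
  have -> : C * eta1 = eta / 4 * (C / (C + 1)).
    by rewrite /eta1; field; move: C1; rewrite pmulr_rgt0// => /gt_eqF ->.
  rewrite ler_piMr ?divr_ge0 ?(ltW eta0)// ler_pdivrMr ?mul1r ?lerDl//.
  by rewrite ltr_wpDl.
have [V [w [u [us ma]]]] := @moment_design R n.+1 N.+1 eta1 e1.
exists V, w, u; split=> // phi lip x x1.
have [w0 w1 u1] := us.
(* Subtracting a constant changes both means equally; then [phi] is bounded by [Lam] on the segment,
   as the coefficient bound requires. *)
wlog phi0 : phi lip / phi 0 = 0.
  move=> H; have cphi := continuous_sin_comp L0 lip.
  have lip' : lipschitz_on_segment Lam (fun t => 1 * phi t + - phi 0).
    move=> s t hs ht; rewrite !mul1r opprD opprK addrACA [- _ + _]addrC subrr addr0.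
    exact: lip.
  have := H _ lip'; rewrite mul1r subrr => /(_ erefl).
  rewrite zonal_mean_affine// mul1r.
  have -> : \sum_v w v * (1 * phi (dot n.+2 (u v) x) + - phi 0) =
     \sum_v w v * phi (dot n.+2 (u v) x) - phi 0.
    under eq_bigr do rewrite mulrDr mul1r.
    by rewrite big_split /= -mulr_suml w1 mul1r.
  by rewrite opprD opprK addrACA [- _ + _]addrC subrr addr0.
pose p := bern N.+1 (fun k => phi (2 * k%:R / N.+1%:R - 1)).
have hp1 t : -1 <= t <= 1 -> `|p.[t] - phi t| <= eta / 4.
  by move=> t1; apply: le_trans Le; exact: bern_approx.
have sp : (size p <= N.+2)%N by exact: size_bern.
have cp j : `|p`_j| <= 2 ^+ N.+1 * Lam.
  apply: coef_bern => k kN; have N0 : 0 < N.+1%:R :> R by rewrite ltr0n.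
  have k0 : 0 <= k%:R / N.+1%:R :> R by rewrite divr_ge0.
  have k1 : k%:R / N.+1%:R <= 1 :> R by rewrite ler_pdivrMr// mul1r ler_nat.
  have s1 : -1 <= 2 * k%:R / N.+1%:R - (1 : R) <= 1.
    by rewrite -mulrA; move: (k%:R / _) k0 k1 => q; lra.
  rewrite -[phi _]subr0 -phi0; apply: le_trans (lip _ _ s1 _) _; first by lra.
  rewrite ler_piMr// subr0 ler_norml; exact: s1.
have h1 : `|\sum_v w v * phi (dot n.+2 (u v) x) - \sum_v w v * p.[dot n.+2 (u v) x]| <= eta / 4.
  rewrite -sumrB; apply: le_trans (ler_norm_sum _ _ _) _.
  apply: (@le_trans _ _ (\sum_v w v * (eta / 4))); last by rewrite -mulr_suml w1 mul1r.
  apply: ler_sum => v _; rewrite -mulrBr normrM (ger0_norm (w0 v)) ler_wpM2l//.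
  by rewrite distrC; apply: hp1; apply: dot_norm_le1; rewrite ?u1 ?x1.
have h2 : `|\sum_v w v * p.[dot n.+2 (u v) x] - zonal_mean n (fun t => p.[t])| <= eta / 4.
  rewrite (zonal_mean_poly _ sp).
  have -> : \sum_v w v * p.[dot n.+2 (u v) x] =
     \sum_(j < N.+2) p`_j * \sum_v w v * dot n.+2 (u v) x ^+ j.
    under eq_bigr do rewrite (horner_coef_wide _ sp) mulr_sumr.
    rewrite exchange_big; apply: eq_bigr => j _ /=; rewrite mulr_sumr.
    by apply: eq_bigr => v _; rewrite mulrCA.
  rewrite -sumrB; apply: le_trans (ler_norm_sum _ _ _) _.
  apply: le_trans CE.
  have -> : C * eta1 = \sum_(j < N.+2) (2 ^+ N.+1 * Lam) * eta1.
    by rewrite sumr_const card_ord /C -[RHS]mulr_natl !mulrA.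
  apply: ler_sum => j _; rewrite -mulrBr normrM.
  apply: ler_pM => //.
  by apply: moment_full ma x1 _ => //; [exact: ltW|rewrite -ltnS].
have cphi := continuous_sin_comp L0 lip.
have chp := @continuous_horner_sin p.
have h3 : `|zonal_mean n (fun t => p.[t]) - zonal_mean n phi| <= eta / 4.
  rewrite ler_norml; apply/andP; split.
    rewrite lerBrDl -[leLHS]/(zonal_mean n phi - eta / 4) -[zonal_mean n phi]mul1r
      -(zonal_mean_affine _ _ _ cphi).
    apply: zonal_mean_le => //.
      by move=> y; apply: cvgD; [apply: cvgM; [exact: cvg_cst|exact: cphi]|exact: cvg_cst].
    by move=> t /hp1; rewrite ler_norml mul1r; lra.
  rewrite lerBlDl -[zonal_mean n phi]mul1r -(zonal_mean_affine _ _ _ cphi).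
  apply: zonal_mean_le => //.
    by move=> y; apply: cvgD; [apply: cvgM; [exact: cvg_cst|exact: cphi]|exact: cvg_cst].
  by move=> t /hp1; rewrite ler_norml mul1r; lra.
move: h1 h2 h3; move: (\sum_v _) (\sum_v _) (zonal_mean _ _) (zonal_mean _ _) => a b c d.
by rewrite !ler_norml; lra.
Qed.

End LipschitzDesign.

(** * Zonal estimates *)

Section Ramp.
Variable R : realType.
Implicit Types a b t y z : R.

(** A Lipschitz function between the indicators of [t >= b] and [t > a]; the first comparison bounds
    cap masses above, the second below. *)
Definition ramp a b t : R := Num.max 0 (Num.min 1 ((t - a) / (b - a))).

Lemma ramp_ge0 a b t : 0 <= ramp a b t.
Proof. by rewrite /ramp le_max lexx. Qed.

Lemma ramp_le1 a b t : ramp a b t <= 1.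
Proof. by rewrite /ramp ge_max ler01 ge_min lexx. Qed.

Lemma ramp_hi a b t : a < b -> b <= t -> ramp a b t = 1.
Proof.
move=> ab bt; rewrite /ramp min_l; first by rewrite max_r.
by rewrite ler_pdivlMr ?subr_gt0// mul1r lerD2r.
Qed.

Lemma ramp_lo a b t : a < b -> t <= a -> ramp a b t = 0.
Proof.
move=> ab ta; rewrite /ramp max_l// ge_min; apply/orP; right.
by rewrite pmulr_lle0 ?invr_gt0 ?subr_gt0// subr_le0.
Qed.

Lemma clamp_lipschitz y z :
  `|Num.max 0 (Num.min 1 y) - Num.max 0 (Num.min 1 z)| <= `|y - z|.
Proof.
have h1 := ler_norm (y - z); have h2 := ler_norm (- (y - z)); rewrite normrN in h2.
rewrite ler_norml; case: (ltP 1 y) => hy; case: (ltP 1 z) => hz;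
  rewrite /Num.max /Num.min; repeat case: ifP; lra.
Qed.

Lemma ramp_lipschitz a b : a < b -> lipschitz_on_segment (b - a)^-1 (ramp a b).
Proof.
move=> ab s t _ _; apply: le_trans (clamp_lipschitz _ _) _.
have -> : (s - a) / (b - a) - (t - a) / (b - a) = (s - t) * (b - a)^-1 by ring.
rewrite normrM mulrC ler_wpM2r//.
by rewrite ger0_norm// invr_ge0 subr_ge0 ltW.
Qed.

Lemma continuous_ramp_sin a b : a < b -> continuous (fun x => ramp a b (sin x)).
Proof.
move=> ab; apply: continuous_sin_comp (ramp_lipschitz ab).
by rewrite invr_ge0 subr_ge0 ltW.
Qed.

End Ramp.

Section ZonalEstimates.
Variable R : realType.
Let hp : R := pi / 2.
Let hp4 : -4 < - hp. Proof. by have := @pihalf_lt2 R; rewrite /hp; lra. Qed.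
Let hp_gt0 : 0 < hp. Proof. by have := @pihalf_ge1 R; rewrite /hp; lra. Qed.
Let hple : - hp <= hp. Proof. by have := hp_gt0; lra. Qed.

Lemma itg_sin_cos n (t : R) : 0 < t < 1 ->
  itg (sc 1 n) (asin t) hp = Num.sqrt (1 - t ^+ 2) ^+ n.+1 / n.+1%:R.
Proof.
move=> /andP[t0 t1]; have ht : -1 <= t <= 1 by apply/andP; split; lra.
have a1 : - hp <= asin t by exact: asin_geNpi2.
have a2 : asin t <= hp by exact: asin_lepi2.
rewrite (@itg_FTC _ (fun x => - n.+1%:R^-1 * sc 0 n.+1 x))//.
- rewrite /sc cos_pihalf cos_asin// expr0n /= expr0 !mul1r; field.
  by rewrite nat1r pnatr_eq0.
- exact: continuous_sc.
- exact: lt_le_trans a1.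
- move=> x _; have := is_derive_sc 0 n.+1 x => h.
  have -> : (fun x : R => - n.+1%:R^-1 * sc 0 n.+1 x) = (- n.+1%:R^-1) *: sc 0 n.+1.
    by apply/funext => y; rewrite fctE.
  apply: is_derive_eq; rewrite /GRing.scale /= /sc.
  by field; rewrite nat1r pnatr_eq0.
Qed.

Lemma ler_sin_segment : {in `[(- hp), hp] &, {mono (@sin R) : x y / x <= y}}.
Proof. by move=> x y hx hy; rewrite !leNgt ltr_sin. Qed.

(* On the support of the ramp, [sin x / t0] is at least 1 and makes the integrand exact. *)
Lemma zonal_ramp_le n (t0 t1 : R) : 0 < t0 -> t0 < t1 -> t1 < 1 ->
  zonal_mean n (ramp t0 t1) <=
  Num.sqrt (1 - t0 ^+ 2) ^+ n.+1 / (t0 * n.+1%:R * wallis R n).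
Proof.
move=> t00 t01 t11.
have ht : -1 <= t0 <= 1 by apply/andP; split; lra.
have a1 : - hp <= asin t0 by exact: asin_geNpi2.
have a2 : asin t0 <= hp by exact: asin_lepi2.
have W0 := @wallis_gt0 R n.
have cr := @continuousM_sc R _ n (continuous_ramp_sin t01).
rewrite /zonal_mean -(itg_cat _ _ (asin t0)).
rewrite ler_pdivrMr//.
have -> : Num.sqrt (1 - t0 ^+ 2) ^+ n.+1 / (t0 * n.+1%:R * wallis R n) * wallis R n =
    0 + t0^-1 * (Num.sqrt (1 - t0 ^+ 2) ^+ n.+1 / n.+1%:R).
  by rewrite add0r; field; rewrite !gt_eqF//= nat1r ltr0n.
apply: lerD.
  have <- : itg (fun=> 0) (- hp) (asin t0) = 0 :> R by rewrite itg_cst// mul0r.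
  apply: le_itg => //; first exact: cst_continuous.
  move=> x /andP[x1 x2]; rewrite ramp_lo ?mul0r//.
  rewrite -(asinK (_ : t0 \in `[(-1), 1])) ?in_itv//=.
  by rewrite ler_sin_segment ?in_itv/= ?a1 ?a2 ?(ltW x1) ?(ltW x2)//= (le_trans (ltW x2)).
rewrite -itg_sin_cos; last by apply/andP; split; lra.
have a4 : -4 < asin t0 by exact: lt_le_trans a1.
rewrite -itgZ//; last exact: continuous_sc.
apply: le_itg => //.
  by move=> x; apply: cvgM; [exact: cvg_cst|exact: continuous_sc].
move=> x /andP[x1 x2]; rewrite /sc expr0 mul1r expr1 mulrA ler_wpM2r//.
  by rewrite exprn_ge0// cos_ge0_pihalf// (le_trans a1) ?(ltW x1)//= ltW.
apply: le_trans (ramp_le1 _ _ _) _.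
rewrite mulrC ler_pdivlMr// mul1r -{1}(asinK (_ : t0 \in `[(-1), 1])) ?in_itv//=.
rewrite ler_sin_segment ?in_itv/= ?a1 ?a2 ?(ltW x1) ?(ltW x2)//=.
by rewrite (le_trans a1)// ltW.
Qed.

(* The asymptotic proportion of the sphere of R^(n+2) within 60 degrees of a point. *)
Definition cap_bound n : R :=
  2 * (Num.sqrt 3 / 2) ^+ n.+1 / Num.sqrt (2 * pi * n.+1%:R).

Lemma cap_bound_gt0 n : 0 < cap_bound n.
Proof.
have n0 : 0 < n.+1%:R :> R by rewrite ltr0n.
rewrite /cap_bound divr_gt0 ?mulr_gt0 ?exprn_gt0 ?divr_gt0 ?sqrtr_gt0 ?ltr0n//.
by rewrite !mulr_gt0// pi_gt0.
Qed.

(** The bound of [zonal_ramp_le] is continuous in [t0], so [t0] close to [1 / 2] costs only the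
    factor [1 + e]. It may depend on [n]: the steepness of the ramp affects only the choice of the
    point system. *)
Lemma cap_ramp n (e : R) : 0 < e ->
  exists t0 : R, [/\ 0 < t0, t0 < 1 / 2 &
    zonal_mean n (ramp t0 (1 / 2)) <= (1 + e) * cap_bound n].
Proof.
move=> e0; have n0 : 0 < n.+1%:R :> R by rewrite ltr0n.
pose g (t : R) := Num.sqrt (1 - t ^+ 2) ^+ n.+1 / t.
have cg : {for (1 / 2 : R), continuous g}.
  apply: cvgM; last by apply: cvgV; [rewrite gt_eqF|exact: cvg_id].
  apply: (@continuous_comp _ _ _ (fun t : R => Num.sqrt (1 - t ^+ 2)) (fun y => y ^+ n.+1));
    last exact: exprn_continuous.
  apply: (@continuous_comp _ _ _ (fun t : R => 1 - t ^+ 2) Num.sqrt);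
    last exact: sqrt_continuous.
  by apply: cvgB; [exact: cvg_cst|exact: exprn_continuous].
have gh : g (1 / 2) = 2 * (Num.sqrt 3 / 2) ^+ n.+1.
  rewrite /g; have -> : 1 - (1 / 2) ^+ 2 = (Num.sqrt 3 / 2) ^+ 2 :> R.
    by rewrite [RHS]expr_div_n sqr_sqrtr//; field.
  rewrite sqrtr_sqr ger0_norm ?divr_ge0 ?sqrtr_ge0// mulrC.
  by congr (_ * _); rewrite div1r invrK.
have g0 : 0 < g (1 / 2).
  by rewrite gh mulr_gt0 ?exprn_gt0 ?divr_gt0 ?sqrtr_gt0.
have ge : 0 < e * g (1 / 2) by rewrite mulr_gt0.
have near_g : \forall t \near (1 / 2 : R)^'-, g t <= (1 + e) * g (1 / 2).
  have cl : g z @[z --> (1 / 2 : R)^'-] --> g (1 / 2) by exact: cvg_at_left_filter.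
  apply: (@cvgr_le _ _ _ _ _ _ cl).
  by have -> : (1 + e) * g (1 / 2) = g (1 / 2) + e * g (1 / 2); [ring|rewrite ltrDl].
near ((1 / 2 : R)^'-) => t0.
have t00 : 0 < t0 by near: t0; apply: nbhs_left_gt; rewrite divr_gt0.
have t01 : t0 < 1 / 2 by near: t0; exact: nbhs_left_lt.
have gt0 : g t0 <= (1 + e) * g (1 / 2) by near: t0.
exists t0; split => //.
apply: le_trans (zonal_ramp_le n t00 t01 _) _; first by lra.
have W0 := @wallis_gt0 R n.
have -> : Num.sqrt (1 - t0 ^+ 2) ^+ n.+1 / (t0 * n.+1%:R * wallis R n) =
    g t0 / (n.+1%:R * wallis R n).
  by rewrite /g; field; rewrite !gt_eqF//= nat1r ltr0n.
rewrite /cap_bound -gh mulrA; apply: ler_pM => //.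
- by rewrite /g divr_ge0 ?(ltW t00)// exprn_ge0// sqrtr_ge0.
- by rewrite invr_ge0 mulr_ge0 ?(ltW W0).
have r0 : 0 < 2 * pi * n.+1%:R :> R by rewrite !mulr_gt0// pi_gt0.
rewrite lef_pV2 ?posrE ?mulr_gt0 ?sqrtr_gt0//.
rewrite -(@ler_pXn2r _ 2)// ?nnegrE ?sqrtr_ge0 ?mulr_ge0 ?(ltW W0)//.
rewrite sqr_sqrtr ?(ltW r0)// exprMn.
apply: (@le_trans _ _ (n.+1%:R ^+ 2 * (wallis R n * wallis R n.+1))).
  rewrite wallis_mul le_eqVlt; apply/orP; left; apply/eqP.
  by field; rewrite nat1r pnatr_eq0.
by rewrite ler_wpM2l ?sqr_ge0// expr2 ler_wpM2l ?(ltW W0) ?wallis_decr.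
Unshelve. all: by end_near. Qed.

Lemma exp_lipschitz (c : R) : 0 <= c ->
  lipschitz_on_segment (c * expR c) (fun t => expR (c * t)).
Proof.
move=> c0 s t; wlog st : s t / s <= t => [H hs ht|].
  case: (leP s t) => [st|/ltW ts]; first exact: H.
  by rewrite distrC [`|s - t|]distrC; exact: H.
move=> hs /andP[t1 t2]; rewrite distrC [`|s - t|]distrC.
rewrite !ger0_norm ?subr_ge0 ?ler_expR ?ler_wpM2l//.
have -> : c * s = c * t + - (c * (t - s)) by ring.
rewrite expRD -{1}[expR (c * t)]mulr1 -mulrBr -mulrA mulrCA mulrC [leRHS]mulrC.
apply: ler_pM; rewrite ?expR_ge0 ?subr_ge0 ?expR_le1 ?oppr_le0 ?mulr_ge0 ?subr_ge0//.
  by have := expR_ge1Dx (- (c * (t - s))); lra.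
by rewrite ler_expR ler_piMr.
Qed.

(** Equality holds at [pi / 4], the source of the rate [1 / Num.sqrt 2]. By [y <= expR (y - 1)] the
    claim reduces to [sin x + cos x <= Num.sqrt 2]. *)
Lemma exp_sin_cos (x : R) :
  expR (Num.sqrt 2 * sin x) * cos x <= expR 1 / Num.sqrt 2.
Proof.
have r0 : 0 < Num.sqrt 2 :> R by rewrite sqrtr_gt0.
have r2 : Num.sqrt 2 ^+ 2 = 2 :> R by rewrite sqr_sqrtr.
rewrite ler_pdivlMr// -mulrA mulrC -ler_pdivlMr ?expR_gt0// -expRB.
have h := cos2Dsin2 x.
move: (sin x) (cos x) (Num.sqrt 2) r0 r2 h => s c r r0 r2 h.
apply: (@le_trans _ _ (expR (c * r - 1))); first by have := expR_ge1Dx (c * r - 1); lra.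
rewrite ler_expR.
have h1 := sqr_ge0 (r - (c + s)); have h2 := sqr_ge0 (c - s).
nra.
Qed.

(** Of the [n.+2] exponential factors, [n] are paired with the cosines through [exp_sin_cos] and the
    other two are at most [expR 3]; [n.+2%:R] bounds [pi / wallis R n]. *)
Lemma zonal_exp_le n :
  zonal_mean n (fun t : R => expR (Num.sqrt 2 * n.+2%:R * t)) <=
  n.+2%:R * expR 3 * (expR 1 / Num.sqrt 2) ^+ n.
Proof.
have W0 := @wallis_gt0 R n; set q := expR 1 / Num.sqrt 2.
have r0 : 0 < Num.sqrt 2 :> R by rewrite sqrtr_gt0.
have q0 : 0 < q by rewrite divr_gt0 ?expR_gt0.
have cs : continuous (fun x : R => expR (Num.sqrt 2 * n.+2%:R * sin x)).
  by apply: continuous_sin_comp (exp_lipschitz _); rewrite ?mulr_ge0 ?expR_ge0// ltW.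
rewrite /zonal_mean ler_pdivrMr//.
apply: (@le_trans _ _ (itg (fun=> expR 3 * q ^+ n) (- hp) hp)).
  apply: le_itg => //; [exact: continuousM_sc|exact: cst_continuous|].
  move=> x /andP[x1 x2]; rewrite /sc expr0 mul1r.
  have c0 : 0 <= cos x by rewrite cos_ge0_pihalf// !ltW.
  have -> : Num.sqrt 2 * n.+2%:R * sin x =
      Num.sqrt 2 * 2 * sin x + n%:R * (Num.sqrt 2 * sin x).
    by rewrite -!natr1; ring.
  rewrite expRD expRM_natl -mulrA -exprMn; apply: ler_pM.
  - exact: expR_ge0.
  - by rewrite exprn_ge0// mulr_ge0// expR_ge0.
  - rewrite ler_expR; have r2 : Num.sqrt 2 ^+ 2 = 2 :> R by rewrite sqr_sqrtr.
    have := sin_le1 x; move: (sin x) (Num.sqrt 2) r0 r2 => s r r0 r2 s1.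
    have h : r * 2 <= 3 by nra.
    by nra.
  - by rewrite lerXn2r ?nnegrE ?mulr_ge0 ?expR_ge0 ?(ltW q0)// exp_sin_cos.
have -> : n.+2%:R * expR 3 * q ^+ n * wallis R n = expR 3 * q ^+ n * (n.+2%:R * wallis R n) by ring.
rewrite itg_cst//; apply: ler_wpM2l.
  by rewrite mulr_ge0 ?expR_ge0// exprn_ge0// ltW.
have -> : hp - - hp = pi by rewrite /hp; field.
rewrite -(@ler_pXn2r _ 2)// ?nnegrE ?pi_ge0 ?mulr_ge0 ?(ltW W0)//.
rewrite exprMn; apply: (@le_trans _ _ (n.+2%:R ^+ 2 * (wallis R n * wallis R n.+1))); last first.
  by rewrite ler_wpM2l ?sqr_ge0// expr2 ler_wpM2l ?(ltW W0) ?wallis_decr.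
have p0 := @pi_gt0 R; have p4 : pi < 4 :> R by have := @pihalf_lt2 R; lra.
rewrite wallis_mul mulrA ler_pdivlMr ?ltr0n//.
have -> : n.+2%:R ^+ 2 * (2 * pi) = pi * (2 * n.+2%:R ^+ 2) :> R by ring.
rewrite expr2 -mulrA ler_pM2l//.
apply: (@le_trans _ _ (4 * n.+1%:R)); first by rewrite ler_wpM2r// ltW.
by rewrite -natrM -natrX -natrM ler_nat; nia.
Qed.

(** On [[x1, x2]] the ramp is 1 and the cosine is bounded below independently of [n]. Any
    exponential rate suffices, as [c] is absorbed later by the choice of [k]; the factor 2 leaves
    room for the sampling error. *)
Lemma zonal_ramp_ge (dl : R) : 0 < dl < 1 -> exists c : R, 0 < c <= 1 /\
  forall n, 2 * c ^+ n.+2 <= zonal_mean n (ramp (1 - dl) (1 - dl / 2)).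
Proof.
move=> /andP[d0 d1]; set b : R := 1 - dl / 2.
have ab : 1 - dl < b by rewrite /b; lra.
have b1 : -1 <= b < 1 by rewrite /b; apply/andP; split; lra.
have b1' : -1 <= b <= 1 by rewrite /b; apply/andP; split; lra.
pose x1 := asin b; have x1h : x1 < hp by exact: asin_ltpi2.
have x1p : - hp <= x1 by exact: asin_geNpi2.
have sx1 : sin x1 = b by rewrite /x1 asinK// in_itv/= b1'.
have x10 : 0 < x1.
  rewrite ltNge; apply/negP => h.
  have : sin x1 <= sin 0.
    by rewrite ler_sin_segment// in_itv/= ?x1p ?(ltW x1h)//= ?(ltW hp_gt0) ?oppr_le0 ?ltW.
  by rewrite sx1 sin0 /b; lra.
pose x2 := (x1 + hp) / 2.
have x12 : x1 < x2 by rewrite /x2; lra.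
have x2h : x2 < hp by rewrite /x2; lra.
have p0 := @pi_gt0 R.
have hpp : hp <= pi by rewrite /hp; lra.
pose B := cos x2; pose A := (x2 - x1) / (2 * pi).
have B0 : 0 < B by apply: cos_gt0_pihalf; rewrite -/hp; apply/andP; split; lra.
have B1 : B <= 1 by exact: cos_le1.
have A0 : 0 < A by rewrite /A divr_gt0 ?subr_gt0// mulr_gt0.
have A1 : A <= 1 by rewrite /A ler_pdivrMr ?mulr_gt0// mul1r; lra.
(* [B] bounds the cosine below and [A] is the length of the interval over [2 * pi]; raising [A] to
   the power [n.+2] too only weakens the bound. *)
exists (A * B); split; first by rewrite mulr_gt0//= mulr_ile1// ltW.
move=> n; have W0 := @wallis_gt0 R n.
have cr := @continuousM_sc R _ n (continuous_ramp_sin ab).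
have r0 x y : - hp <= x -> x <= y -> y <= hp ->
    0 <= itg (fun z => ramp (1 - dl) b (sin z) * sc 0 n z) x y.
  move=> hx xy hy; have x4 := lt_le_trans hp4 hx.
  have <- : itg (fun=> 0) x y = 0 :> R by rewrite itg_cst// mul0r.
  apply: le_itg => //; first exact: cst_continuous.
  move=> z /andP[z1 z2]; rewrite mulr_ge0 ?ramp_ge0// sc0_ge0//.
  by rewrite (le_lt_trans hx)// (lt_le_trans z2).
rewrite /zonal_mean -/hp ler_pdivlMr//.
rewrite -(itg_cat _ _ x1) -(itg_cat _ x1 x2).
have h1 := r0 _ _ (lexx _) x1p (ltW x1h).
have h2 : 0 <= itg (fun z => ramp (1 - dl) b (sin z) * sc 0 n z) x2 hp.
  by apply: r0 => //; [rewrite (le_trans x1p)// ltW|exact: ltW].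
suff h3 : 2 * (A * B) ^+ n.+2 * wallis R n <=
    itg (fun z => ramp (1 - dl) b (sin z) * sc 0 n z) x1 x2 by lra.
have x14 : -4 < x1 by exact: lt_le_trans x1p.
apply: (@le_trans _ _ (itg (fun=> B ^+ n) x1 x2)); last first.
  apply: le_itg => //; [exact: cst_continuous|exact: ltW|].
  move=> z /andP[z1 z2]; rewrite ramp_hi//; last first.
    rewrite -sx1 ler_sin_segment ?in_itv/= ?x1p ?(ltW x1h) ?(ltW z1)//=.
    by rewrite (le_trans x1p) ?(ltW z1)//= (le_trans (ltW z2))// ltW.
  rewrite mul1r /sc expr0 mul1r lerXn2r ?nnegrE ?(ltW B0)//.
    rewrite cos_ge0_pihalf// -/hp; apply/andP; split; lra.
  rewrite /B leNgt ltr_cos ?in_itv/=.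
  - by rewrite -leNgt ltW.
  - apply/andP; split; lra.
  - apply/andP; split; lra.
rewrite itg_cst ?(ltW x12)//.
have -> : x2 - x1 = A * (2 * pi) by rewrite /A divfK// gt_eqF// mulr_gt0.
rewrite exprMn.
have hA : A ^+ n.+2 <= A by rewrite exprS ler_piMr ?(ltW A0)// exprn_ile1// ltW.
have hB : B ^+ n.+2 <= B ^+ n.
  by rewrite !exprS mulrA ler_piMl ?exprn_ge0 ?(ltW B0)// mulr_ile1// ltW.
have -> : B ^+ n * (A * (2 * pi)) = 2 * (A * B ^+ n) * pi by ring.
apply: ler_pM; rewrite ?wallis_le_pi ?(ltW W0)//.
  by rewrite mulr_ge0// mulr_ge0// exprn_ge0// ltW.
by rewrite ler_pM2l// ler_pM ?exprn_ge0 ?(ltW A0) ?(ltW B0).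
Qed.

End ZonalEstimates.

(** The constant [c] precedes [n], so that [k] can later be fixed before the dimension, whereas the
    Lipschitz constants and the tolerance may depend on [n]. Each of the three estimates leaves room
    for one [eta]. *)
Theorem point_system (R : realType) (e dl : R) : 0 < e -> 0 < dl < 1 ->
  exists c : R, 0 < c <= 1 /\ forall n, exists (V : finType) (w : V -> R) (u : V -> nat -> R),
  [/\ unit_system n.+2 w u,
      forall x, dot n.+2 x x = 1 ->
        \sum_(v | 1 / 2 <= dot n.+2 (u v) x) w v <= (1 + e) * cap_bound R n,
      forall x, dot n.+2 x x = 1 ->
        \sum_v w v * expR (Num.sqrt 2 * n.+2%:R * dot n.+2 (u v) x) <=
        2 * n.+2%:R * expR 3 * (expR 1 / Num.sqrt 2) ^+ n &
      forall x, dot n.+2 x x = 1 ->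
        c ^+ n.+2 <= \sum_(v | 1 - dl <= dot n.+2 (u v) x) w v].
Proof.
move=> e0 dl01; have [c [/andP[c0 c1] hc]] := zonal_ramp_ge dl01.
exists c; split; first by rewrite c0.
move=> n; have e2 : 0 < e / 2 by rewrite divr_gt0.
have [t0 [t00 t01 ht0]] := cap_ramp n e2.
set q := expR 1 / Num.sqrt 2.
have r0 : 0 < Num.sqrt 2 :> R by rewrite sqrtr_gt0.
have q0 : 0 < q by rewrite divr_gt0 ?expR_gt0.
set a := Num.sqrt 2 * n.+2%:R.
have a0 : 0 <= a by rewrite mulr_ge0// ltW.
have ab : 1 - dl < 1 - dl / 2 by case/andP: dl01; lra.
pose L1 := (1 / 2 - t0)^-1; pose L2 := a * expR a; pose L3 := (1 - dl / 2 - (1 - dl))^-1.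
have L10 : 0 <= L1 by rewrite invr_ge0 subr_ge0 ltW.
have L20 : 0 <= L2 by rewrite mulr_ge0 ?expR_ge0.
have L30 : 0 <= L3 by rewrite invr_ge0 subr_ge0 ltW.
have L0 : 0 <= L1 + L2 + L3 by rewrite !addr_ge0.
pose e1 := e / 2 * cap_bound R n.
pose E := n.+2%:R * expR 3 * q ^+ n.
have e10 : 0 < e1 by rewrite mulr_gt0 ?cap_bound_gt0.
have E0 : 0 < E by rewrite !mulr_gt0 ?expR_gt0 ?exprn_gt0 ?ltr0n.
pose eta := Num.min e1 (Num.min E (c ^+ n.+2)).
have eta0 : 0 < eta by rewrite !lt_min e10 E0 exprn_gt0.
have [m1 m2 m3] : [/\ eta <= e1, eta <= E & eta <= c ^+ n.+2].
  by rewrite /eta !ge_min !lexx !orbT.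
have [V [w [u [us hd]]]] := lipschitz_design n L0 eta0.
have lipW (L : R) phi : L <= L1 + L2 + L3 -> lipschitz_on_segment L phi ->
    lipschitz_on_segment (L1 + L2 + L3) phi.
  by move=> hL lip s t hs ht; apply: le_trans (lip s t hs ht) _; rewrite ler_wpM2r.
have [w0 w1 u1] := us.
exists V, w, u; split => // x x1.
- have := hd _ (lipW _ _ _ (ramp_lipschitz t01)) x x1; rewrite -/L1 => h.
  have {}h := h (ltac:(lra)).
  have : \sum_(v | 1 / 2 <= dot n.+2 (u v) x) w v <=
      \sum_v w v * ramp t0 (1 / 2) (dot n.+2 (u v) x).
    rewrite big_mkcond; apply: ler_sum => v _; case: ifP => hv.
      by rewrite ramp_hi// mulr1.
    by rewrite mulr_ge0 ?ramp_ge0.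
  move: h ht0 m1; rewrite ler_norml /e1; move: (cap_bound R n) => z; lra.
- have := hd _ (lipW _ _ _ (exp_lipschitz a0)) x x1; rewrite -/L2 => h.
  have {}h := h (ltac:(lra)).
  have hE := zonal_exp_le R n; rewrite -/q -/a in hE.
  have -> : 2 * n.+2%:R * expR 3 * q ^+ n = E + E by rewrite /E; ring.
  by move: h hE m2; rewrite ler_norml -/E; lra.
- have := hd _ (lipW _ _ _ (ramp_lipschitz ab)) x x1; rewrite -/L3 => h.
  have {}h := h (ltac:(lra)).
  have : \sum_v w v * ramp (1 - dl) (1 - dl / 2) (dot n.+2 (u v) x) <=
      \sum_(v | 1 - dl <= dot n.+2 (u v) x) w v.
    rewrite [leRHS]big_mkcond; apply: ler_sum => v _; case: ifPn => hv.
      by rewrite ler_piMr// ramp_le1.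
    by rewrite ramp_lo ?mulr0// ltW// ltNge.
  by move: h (hc n) m3; rewrite ler_norml; lra.
Qed.

(** * From codes to kissing configurations *)

Section Kissing.
Variables (R : realType) (d : nat).

Lemma unit_ballE (c y : 'rV[R]_d) :
  unit_ball c y -> \sum_(i < d) (y ord0 i - c ord0 i) ^+ 2 <= 1.
Proof.
rewrite /unit_ball /enorm /= -[X in _ <= X -> _]sqrtr1 ler_sqrt// => h.
apply: le_trans h; rewrite le_eqVlt; apply/orP; left; apply/eqP.
by apply: eq_bigr => i _; rewrite !mxE.
Qed.

(* If z were interior to both balls, moving z by t (a - b) would keep it in the ball
   around b, while (1 + t) (a - b) is a difference of two vectors of norm at most 1. *)
Lemma nonoverlapping_dist (a b : 'rV[R]_d) :
  4 <= \sum_(i < d) (a ord0 i - b ord0 i) ^+ 2 ->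
  nonoverlapping (unit_ball a) (unit_ball b).
Proof.
move=> hab; rewrite /nonoverlapping; apply/seteqP; split => // z [za zb].
have /unit_ballE ha := interior_subset za.
move: zb => /nbhs_ballP[r r0 hr].
pose m := \sum_(i < d) `|a ord0 i - b ord0 i|.
have m0 : 0 <= m by apply: sumr_ge0.
have m1 : 0 < m + 1 by rewrite ltr_wpDl.
pose t := r / (m + 1); have t0 : 0 < t by rewrite divr_gt0.
pose y : 'rV[R]_d := \row_i (z ord0 i + t * (a ord0 i - b ord0 i)).
have /unit_ballE hb : unit_ball b y.
  apply: hr; split => // i j; rewrite ord1 /ball /= !mxE.
  rewrite opprD addNKr normrN normrM gtr0_norm//.
  rewrite /t mulrAC ltr_pdivrMr// ltr_pM2l//.
  apply: le_lt_trans (_ : m < _); last by rewrite ltrDl.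
  by rewrite /m (bigD1 j)//= lerDl sumr_ge0.
have : (1 + t) ^+ 2 * 4 <= 4.
  apply: (@le_trans _ _ ((1 + t) ^+ 2 * \sum_(i < d) (a ord0 i - b ord0 i) ^+ 2)).
    by rewrite ler_wpM2l ?sqr_ge0.
  apply: (@le_trans _ _ (2 * (\sum_(i < d) (y ord0 i - b ord0 i) ^+ 2) +
     2 * \sum_(i < d) (z ord0 i - a ord0 i) ^+ 2)); last by lra.
  rewrite !mulr_sumr -big_split; apply: ler_sum => i _ /=; rewrite mxE.
  move: (z ord0 i) (a ord0 i) (b ord0 i) => p q s.
  rewrite -subr_ge0.
  have -> : 2 * (p + t * (q - s) - s) ^+ 2 + 2 * (p - q) ^+ 2 -
    (1 + t) ^+ 2 * (q - s) ^+ 2 = (p + t * (q - s) - s + (p - q)) ^+ 2 by ring.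
  exact: sqr_ge0.
by have := sqr_ge0 t; nra.
Qed.

(** The balls are centred at the points [2 u] and touch the ball at the origin in [u]. Independence
    makes inner products less than [1 / 2], so squared distances [8 - 8 <u, u'>] exceed 4. *)
Lemma kissing_of_code (V : finType) (u : V -> nat -> R) (I : {set V}) :
  (forall v, dot d (u v) (u v) = 1) -> indep (close d u) I -> kissing R d #|I|.
Proof.
move=> u1 /indepP hI.
pose x (i : 'I_#|I|) : 'rV[R]_d := \row_j (2 * u (enum_val i) j).
exists 0, x; split.
  move=> i; split.
    exists (\row_j u (enum_val i) j); split; rewrite /unit_ball /enorm /=.
      rewrite -[leRHS]sqrtr1 ler_wsqrtr// -[leRHS](u1 (enum_val i)).
      rewrite le_eqVlt; apply/orP; left; apply/eqP.
      by apply: eq_bigr => j _; rewrite !mxE; ring.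
    rewrite -[leRHS]sqrtr1 ler_wsqrtr// -[leRHS](u1 (enum_val i)).
    rewrite le_eqVlt; apply/orP; left; apply/eqP.
    by apply: eq_bigr => j _; rewrite !mxE; ring.
  apply: nonoverlapping_dist.
  have -> : \sum_(j < d) (x i ord0 j - (0 : 'rV[R]_d) ord0 j) ^+ 2 =
      4 * dot d (u (enum_val i)) (u (enum_val i)).
    by rewrite /dot mulr_sumr; apply: eq_bigr => j _; rewrite !mxE; ring.
  by rewrite u1 mulr1.
move=> i j ij; apply: nonoverlapping_dist.
have -> : \sum_(l < d) (x i ord0 l - x j ord0 l) ^+ 2 =
    4 * dot d (u (enum_val i)) (u (enum_val i)) +
    4 * dot d (u (enum_val j)) (u (enum_val j)) -
    8 * dot d (u (enum_val i)) (u (enum_val j)).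
  rewrite /dot !mulr_sumr -big_split -sumrB; apply: eq_bigr => l _ /=.
  by rewrite !mxE; ring.
rewrite !u1.
suff : dot d (u (enum_val i)) (u (enum_val j)) < 1 / 2 by lra.
rewrite ltNge; apply/negP => h.
have /enum_val_inj e := hI _ _ (enum_valP i) (enum_valP j) h.
by rewrite e eqxx in ij.
Qed.

Lemma kissing_number_ge n : kissing R d n -> (n <= kissing_number R d)%N.
Proof. by have [_] := kissing_numberP R d; apply. Qed.

End Kissing.

(** * Growth rates and the target function *)

Section Growth.
Variable R : realType.

Lemma poly_exp_decay (C c : R) m : 0 <= C -> 0 < c ->
  exists N, forall d, (N <= d)%N -> C * d%:R ^+ m * expR (- (c * d%:R)) <= 1.
Proof.
move=> C0 c0; pose B := C * m.+1`!%:R / c ^+ m.+1.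
have f0 : 0 < m.+1`!%:R :> R by rewrite ltr0n fact_gt0.
have B0 : 0 <= B by rewrite divr_ge0 ?mulr_ge0 ?exprn_ge0 ?(ltW c0).
exists (Num.truncn B).+1 => d dN.
have Bd : B <= d%:R.
  have /andP[_ /ltW h] := truncn_itv B0.
  by apply: le_trans h _; rewrite ler_nat.
have d0 : 0 < d%:R :> R by rewrite ltr0n (leq_trans _ dN).
rewrite expRN ler_pdivrMr ?expR_gt0// mul1r.
have x0 : 0 <= c * d%:R by rewrite mulr_ge0 ?(ltW c0) ?(ltW d0).
have h := expR_ge1Dxn m x0.
apply: (@le_trans _ _ ((c * d%:R) ^+ m.+1 / m.+1`!%:R)); last by apply: le_trans h; rewrite lerDr.
rewrite ler_pdivlMr// exprMn (exprS d%:R) mulrAC [leRHS]mulrA.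
rewrite ler_wpM2r ?exprn_ge0 ?(ltW d0)//.
by move: Bd; rewrite /B ler_pdivrMr ?exprn_gt0// mulrC [leRHS]mulrC.
Qed.

Definition kissing_asymp d : R :=
  Num.sqrt (3 * pi) / (4 * Num.sqrt 2) * ln (3 / 2) * d%:R `^ (3 / 2) *
  (2 / Num.sqrt 3) ^+ d.

Lemma ln32_gt0 : 0 < ln (3 / 2) :> R.
Proof. by apply: ln_gt0; lra. Qed.

Lemma ln32_le : ln (3 / 2) <= 1 / 2 :> R.
Proof.
have -> : 3 / 2 = 1 + 1 / 2 :> R by lra.
by apply: le_ln1Dx; lra.
Qed.

(** The target is the hard-core estimate [d / 2 * ln (3 / 2)] over the cap bound; the last factor
    appears because [cap_bound] contains the square root of [d - 1] rather than of [d]. *)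
Lemma kissing_asympE n : kissing_asymp n.+2 =
  n.+2%:R / 2 * ln (3 / 2) / cap_bound R n * Num.sqrt (n.+2%:R / n.+1%:R).
Proof.
have n1 : 0 < n.+1%:R :> R by rewrite ltr0n.
have n2 : 0 < n.+2%:R :> R by rewrite ltr0n.
have p0 := @pi_gt0 R.
have s2 : 0 < Num.sqrt 2 :> R by rewrite sqrtr_gt0.
have s3 : 0 < Num.sqrt 3 :> R by rewrite sqrtr_gt0.
have sp : 0 < Num.sqrt pi :> R by rewrite sqrtr_gt0.
have sn1 : 0 < Num.sqrt n.+1%:R :> R by rewrite sqrtr_gt0.
rewrite /kissing_asymp /cap_bound.
have -> : (3 / 2 : R) = 1 + 2^-1 by field.
rewrite powRD; last by rewrite gt_eqF// implybT.
rewrite powRr1 ?ler0n// powR12_sqrt ?ler0n//.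
rewrite !sqrtrM ?mulr_ge0 ?pi_ge0 ?ler0n// sqrtrV ?ler0n//.
have -> : (2 / Num.sqrt 3) ^+ n.+2 = ((Num.sqrt 3 / 2) ^+ n.+1)^-1 * (2 / Num.sqrt 3) :> R.
  by rewrite -exprVn invf_div exprSr.
set P := (Num.sqrt 3 / 2) ^+ n.+1.
have P0 : 0 < P by rewrite exprn_gt0// divr_gt0.
have r2 : Num.sqrt 2 ^+ 2 = 2 :> R by rewrite sqr_sqrtr.
have e1 : Num.sqrt n.+1%:R != 0 :> R by rewrite gt_eqF.
move: (ln _) => l; move: (Num.sqrt n.+1%:R) (Num.sqrt n.+2%:R) e1 => x y e1.
move: (Num.sqrt 2) (Num.sqrt 3) (Num.sqrt pi) s2 s3 r2 sp => a b c a0 b0 r2 c0.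
have -> : 4 * a = 8 / a.
  by rewrite (_ : 8 = 4 * a ^+ 2); [field; rewrite gt_eqF|rewrite r2; lra].
by field; rewrite e1 !gt_eqF.
Qed.

End Growth.

(** * Choice of the parameters *)

Section Main.
Variable R : realType.

(* As k does not depend on n, the four decay conditions hold for all large n. *)
Lemma code_of_system (e e1 dl c C : R) (k n : nat) (d := n.+2) (l := ln (3 / 2) : R) :
  0 < e < 1 -> e1 = e * l / 4 -> dl = e1 / 2 -> 0 < c <= 1 -> C = 2 * expR 3 ->
  (0 < k)%N -> - ln c <= k%:R * (e1 / 4) ->
  2 * C / e * d%:R ^+ 2 * expR (- (e1 / 4 * d%:R)) <= 1 ->
  2 * C / e ^+ k * d%:R ^+ k.+1 * expR (- (e1 * d%:R)) <= 1 ->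
  8 / ((1 - e) ^+ 2 * l) * d%:R ^+ 1 * expR (- (e1 * d%:R)) <= 1 ->
  e^-1 * d%:R ^+ 1 * expR (- (2 * (1 - e) * e1 * d%:R)) <= 1 ->
  forall (V : finType) (w : V -> R) (u : V -> nat -> R),
  unit_system d w u ->
  (forall x, dot d x x = 1 ->
     \sum_(v | 1 / 2 <= dot d (u v) x) w v <= (1 + e) * cap_bound R n) ->
  (forall x, dot d x x = 1 ->
     \sum_v w v * expR (Num.sqrt 2 * d%:R * dot d (u v) x) <=
     C * d%:R * (expR 1 / Num.sqrt 2) ^+ n) ->
  (forall x, dot d x x = 1 -> c ^+ d <= \sum_(v | 1 - dl <= dot d (u v) x) w v) ->
  exists2 I : {set V}, indep (close d u) I &
    (1 - e) ^+ 4 * (d%:R / 2 * l) <= #|I|%:R * ((1 + e) * cap_bound R n).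
Proof.
move=> /andP[e0 e1'] e1E dlE /andP[c0 cle1] CE k0 hk g1 g2 g3 g4 V w u us hcap hexp hmass.
have [w0 w1 u1] := us.
have l0 : 0 < l := ln32_gt0 R; have l2 : l <= 1 / 2 := ln32_le R.
have e10 : 0 < e1 by rewrite e1E !mulr_gt0.
have el1 : e * l <= 1 by apply: mulr_ile1; lra.
have e1s : e1 <= 1 by rewrite e1E; lra.
have D0 : 0 < d%:R :> R by rewrite ltr0n.
have D1 : 1 <= d%:R :> R by rewrite ler1n.
have C0 : 0 < C by rewrite CE mulr_gt0 ?expR_gt0.
have dl01 : 0 <= dl <= 1 by rewrite dlE; apply/andP; split; lra.
have s20 : 0 < Num.sqrt 2 :> R by rewrite sqrtr_gt0.
pose X : R := (Num.sqrt 2)^-1 ^+ d.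
have X0 : 0 < X by rewrite exprn_gt0// invr_gt0.
set E0 := C * d%:R * (expR 1 / Num.sqrt 2) ^+ n.
have E0X : E0 * expR (- d%:R) <= C * d%:R * X.
  have q1 : 1 <= expR 1 / Num.sqrt 2 :> R.
    by have := exp_sin_cos (0 : R); rewrite sin0 cos0 mulr0 expR0 mulr1.
  have qn : (expR 1 / Num.sqrt 2) ^+ n <= (expR 1 / Num.sqrt 2) ^+ d :> R.
    by rewrite ler_weXn2l// /d -addn2 leq_addr.
  rewrite /E0 -mulrA ler_wpM2l ?mulr_ge0 ?(ltW C0)//.
  apply: (@le_trans _ _ ((expR 1 / Num.sqrt 2) ^+ d * expR (- d%:R))).
    by rewrite ler_wpM2r ?expR_ge0.
  rewrite exprMn -expRM_natl mulr1 mulrAC -expRD subrr expR0 mul1r.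
  by rewrite exprVn /X exprVn.
have E00 : 0 <= E0 by rewrite !mulr_ge0 ?exprn_ge0 ?divr_ge0 ?expR_ge0 ?(ltW C0) ?(ltW s20).
(* [X] is the exponential order of the mass of a 45 degree cap; the extra factor is what makes
   heavier sets sparse. *)
pose D := expR (e1 * d%:R) * X.
have DD0 : 0 < D by rewrite mulr_gt0 ?expR_gt0.
pose s := (1 + e) * cap_bound R n.
have s0 : 0 < s by rewrite mulr_gt0 ?cap_bound_gt0 ?addr_gt0.
(* With [la * s = expR z1], the gap [z1 - M = e * z1] makes the second alternative of the hard-core
   bound exponentially large. The gap [2 * e1 * d%:R] between [z1] and [d%:R / 2 * l] pays for the
   excess in [D]. *)
pose z1 := (1 - e) * (d%:R / 2 * l); pose M := (1 - e) * z1.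
pose la := expR z1 / s.
(* As [M <= d%:R], the correction [M ^+ 2 * p] is at most [e * M]. *)
pose p := e / d%:R.
have oe : 0 < 1 - e by rewrite subr_gt0.
have z10 : 0 < z1 by rewrite !mulr_gt0 ?divr_gt0.
have M0 : 0 < M by rewrite mulr_gt0.
have la0 : 0 < la by rewrite divr_gt0 ?expR_gt0.
have Md : M <= d%:R.
  have h1 : d%:R / 2 * l <= d%:R.
    by rewrite -mulrA ler_piMr ?(ltW D0)//; lra.
  have h0 : 0 <= d%:R / 2 * l by rewrite mulr_ge0 ?divr_ge0 ?(ltW D0) ?(ltW l0).
  have oe1 : 1 - e <= 1 by lra.
  rewrite /M /z1 mulrA; apply: le_trans (_ : 1 * (d%:R / 2 * l) <= _); last by rewrite mul1r.
  by rewrite ler_wpM2r// mulr_ile1// ltW.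
have p0 : 0 <= p by rewrite divr_ge0 ?(ltW e0) ?(ltW D0).
have kap0 : 0 < c ^+ d by rewrite exprn_gt0.
have E1 : E0 * expR (- d%:R) / D <= C * d%:R * expR (- (e1 * d%:R)).
  rewrite ler_pdivrMr//; apply: le_trans E0X _.
  have -> : C * d%:R * expR (- (e1 * d%:R)) * D =
      C * d%:R * X * (expR (- (e1 * d%:R)) * expR (e1 * d%:R)) by rewrite /D; ring.
  by rewrite -expRD addNr expR0 mulr1.
have sparse : (c ^+ d)^-1 * (E0 * expR (- (d%:R * (1 - dl))) / D) ^+ k +
    E0 * expR (- d%:R) / D <= p ^+ k.
  (* The mass [c ^+ d] is exponentially small but occurs once against a [k]-th power; [k] is so
     large that each factor pays only [expR (e1 / 4 * d%:R)]. *)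
  have kapE : (c ^+ d)^-1 <= expR (e1 / 4 * d%:R) ^+ k.
    have -> : c = expR (ln c) by rewrite lnK.
    rewrite -expRM_natl -expRN -expRM_natl ler_expR.
    have := ler_wpM2r (ltW D0) hk; lra.
  have E2 : E0 * expR (- (d%:R * (1 - dl))) / D <= C * d%:R * expR (- (e1 / 2 * d%:R)).
    have -> : - (d%:R * (1 - dl)) = - d%:R + e1 / 2 * d%:R by rewrite dlE; ring.
    rewrite expRD mulrA mulrAC.
    apply: le_trans (ler_wpM2r (expR_ge0 _) E1) _.
    rewrite -[leLHS]mulrA -expRD ler_wpM2l ?mulr_ge0 ?(ltW C0) ?(ltW D0)//.
    by rewrite ler_expR; lra.
  have pk0 : 0 < p ^+ k by rewrite exprn_gt0// divr_gt0.
  have t1 : (c ^+ d)^-1 * (E0 * expR (- (d%:R * (1 - dl))) / D) ^+ k <= 1 / 2 * p ^+ k.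
    apply: (@le_trans _ _ ((expR (e1 / 4 * d%:R) * (C * d%:R * expR (- (e1 / 2 * d%:R)))) ^+ k)).
      rewrite [leRHS]exprMn; apply: ler_pM => //.
      - by rewrite invr_ge0 ltW.
      - by rewrite exprn_ge0// divr_ge0 ?(ltW DD0)// mulr_ge0 ?expR_ge0.
      - rewrite lerXn2r ?nnegrE//; first by rewrite divr_ge0 ?(ltW DD0)// mulr_ge0 ?expR_ge0.
        by rewrite !mulr_ge0 ?expR_ge0 ?(ltW C0) ?(ltW D0).
    have -> : expR (e1 / 4 * d%:R) * (C * d%:R * expR (- (e1 / 2 * d%:R))) =
        C * d%:R * expR (- (e1 / 4 * d%:R)).
      by rewrite mulrCA -expRD; congr (_ * expR _); field.
    apply: (@le_trans _ _ ((1 / 2 * p) ^+ k)).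
      have q1 : 0 <= C * d%:R * expR (- (e1 / 4 * d%:R)).
        by rewrite !mulr_ge0 ?expR_ge0 ?(ltW C0) ?(ltW D0).
      have q2 : 0 <= 1 / 2 * p by rewrite mulr_ge0// divr_ge0.
      rewrite lerXn2r ?nnegrE//.
      have -> : C * d%:R * expR (- (e1 / 4 * d%:R)) =
          1 / 2 * p * (2 * C / e * d%:R ^+ 2 * expR (- (e1 / 4 * d%:R))).
        by rewrite /p; field; rewrite !gt_eqF.
      by rewrite ler_piMr// mulr_ge0// divr_ge0.
    rewrite exprMn ler_wpM2r ?(ltW pk0)//.
    by rewrite -(prednK k0) exprS ler_piMr ?divr_ge0// exprn_ile1// ?divr_ge0//; lra.
  have t2 : E0 * expR (- d%:R) / D <= 1 / 2 * p ^+ k.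
    apply: le_trans E1 _.
    have -> : C * d%:R * expR (- (e1 * d%:R)) =
        1 / 2 * p ^+ k * (2 * C / e ^+ k * d%:R ^+ k.+1 * expR (- (e1 * d%:R))).
      rewrite /p expr_div_n (exprS d%:R).
      move: (expf_neq0 k (lt0r_neq0 e0)) (expf_neq0 k (lt0r_neq0 D0)).
      move: (e ^+ k) (d%:R ^+ k) (expR _) => a b z a0 b0.
      by field; rewrite a0 b0.
    by rewrite ler_piMr// mulr_ge0// ?divr_ge0// ltW.
  by lra.
(* The rates balance: [Num.sqrt (3 / 2) ^+ d * X] is [(Num.sqrt 3 / 2) ^+ d], at most
   [4 * d%:R * s]. This forces the number [3 / 2]; the spare [expR (- (e1 * d%:R))] beats the
   polynomial. *)
have laD : la * D <= M.
  have n1 : 0 < n.+1%:R :> R by rewrite ltr0n.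
  have s30 : 0 < Num.sqrt 3 :> R by rewrite sqrtr_gt0.
  have pp := @pi_gt0 R; have p4 : pi < 4 :> R by have := @pihalf_lt2 R; lra.
  have p2 := @pi_ge2 R.
  have nd : n.+1%:R <= d%:R :> R by rewrite ler_nat.
  have q0 : 0 <= 2 * pi * n.+1%:R :> R by rewrite !mulr_ge0// ltW.
  have sq8 : Num.sqrt (2 * pi * n.+1%:R) <= 8 * d%:R :> R.
    rewrite -(@ler_pXn2r _ 2)// ?nnegrE ?sqrtr_ge0 ?mulr_ge0 ?(ltW D0)//.
    rewrite sqr_sqrtr//; apply: (@le_trans _ _ (8 * d%:R)).
      by apply: ler_pM; rewrite ?mulr_ge0 ?(ltW pp) ?(ltW n1)//; lra.
    by rewrite expr2 ler_peMl ?mulr_ge0 ?(ltW D0)//; lra.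
  have ez : expR z1 = (Num.sqrt (3 / 2)) ^+ d * expR (- (2 * e1 * d%:R)).
    have -> : Num.sqrt (3 / 2) = expR (l / 2) :> R.
      rewrite -powR12_sqrt; last by lra.
      by rewrite [l / 2]mulrC /l -ln_powR lnK// posrE powR_gt0//; lra.
    rewrite -expRM_natl -expRD; congr expR.
    by rewrite /z1 e1E; field.
  have XE : Num.sqrt (3 / 2) ^+ d * X = (Num.sqrt 3 / 2) ^+ d.
    rewrite /X -exprMn; congr (_ ^+ _); rewrite sqrtrM// sqrtrV// -mulrA -invfM.
    by rewrite -expr2 sqr_sqrtr.
  have Ds : (Num.sqrt 3 / 2) ^+ d / s <= 4 * d%:R.
    have b1 : Num.sqrt 3 / 2 <= 1 :> R.
      rewrite ler_pdivrMr// mul1r -(@ler_pXn2r _ 2)// ?nnegrE ?sqrtr_ge0//.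
      by rewrite sqr_sqrtr//; lra.
    have b0 : 0 < Num.sqrt 3 / 2 :> R by rewrite divr_gt0.
    rewrite ler_pdivrMr// /s /cap_bound.
    have P0 : 0 < (Num.sqrt 3 / 2) ^+ n.+1 :> R by rewrite exprn_gt0.
    have S0 : 0 < Num.sqrt (2 * pi * n.+1%:R) :> R by rewrite sqrtr_gt0 !mulr_gt0.
    apply: (@le_trans _ _ ((Num.sqrt 3 / 2) ^+ n.+1)).
      by rewrite /d exprS ler_piMl// ltW.
    move: sq8 P0 S0; move: (Num.sqrt (2 * pi * n.+1%:R)) ((Num.sqrt 3 / 2) ^+ n.+1) => S P h P0 S0.
    have -> : 4 * d%:R * ((1 + e) * (2 * P / S)) = P * ((1 + e) * (8 * d%:R / S)).
      by field; rewrite gt_eqF.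
    rewrite ler_peMr ?(ltW P0)//.
    have h8 : 1 <= 8 * d%:R / S by rewrite ler_pdivlMr// mul1r.
    by apply: mulr_ege1 => //; lra.
  have -> : la * D = (Num.sqrt 3 / 2) ^+ d / s * expR (- (e1 * d%:R)).
    rewrite -XE /la /D ez.
    have -> : - (e1 * d%:R) = - (2 * e1 * d%:R) + e1 * d%:R by ring.
    by rewrite expRD; field; rewrite gt_eqF.
  apply: le_trans (ler_wpM2r (expR_ge0 _) Ds) _.
  have K0 : 0 < (1 - e) ^+ 2 * l by rewrite mulr_gt0 ?exprn_gt0.
  have -> : 4 * d%:R * expR (- (e1 * d%:R)) = (1 - e) ^+ 2 * l / 2 *
     (8 / ((1 - e) ^+ 2 * l) * d%:R ^+ 1 * expR (- (e1 * d%:R))).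
    by rewrite expr1; field; rewrite !gt_eqF.
  apply: (@le_trans _ _ ((1 - e) ^+ 2 * l / 2)).
    by rewrite ler_piMr// divr_ge0// ltW.
  have -> : M = (1 - e) ^+ 2 * l / 2 * d%:R by rewrite /M /z1; ring.
  by rewrite ler_peMr// divr_ge0// ltW.
have Mp : (1 - e) * M <= M - M ^+ 2 * p.
  have -> : M - M ^+ 2 * p = (1 - M * p) * M by ring.
  rewrite ler_pM2r// lerD2l lerN2 /p mulrA ler_pdivrMr// mulrC ler_pM2l//.
have adjxx : reflexive (close d u) by move=> v; rewrite /close u1; lra.
have adjC : symmetric (close d u) by move=> a b; rewrite /close dotC.
have [] := @hard_core_bound R V (close d u) w adjxx adjC w0 s la D M p e s0 la0 M0 _ w1 _ _ laD _.
- by rewrite e0.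
- move=> v; rewrite /wt /s; apply: le_trans (hcap _ (u1 v)).
  rewrite le_eqVlt; apply/orP; left; apply/eqP; apply: eq_bigl => y.
  by rewrite inE /close dotC.
- move=> T DT; apply: (@close_pairs_sparse R d V w u w0 w1 E0 dl (c ^+ d)) sparse DT => //.
- by apply: le_trans Mp; rewrite mulr_ge0 ?(ltW oe) ?(ltW M0).
move=> I iI hI; exists I => //.
apply: le_trans hI; rewrite le_min; apply/andP; split.
  have -> : (1 - e) ^+ 4 * (d%:R / 2 * l) = (1 - e) * ((1 - e) * M).
    by rewrite /M /z1; ring.
  by rewrite ler_pM2l.
have -> : la * s * expR (- M) = expR (2 * (1 - e) * e1 * d%:R).
  rewrite /la divfK ?gt_eqF// -expRD; congr expR.
  by rewrite /M /z1 e1E; field.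
apply: (@le_trans _ _ d%:R).
  apply: le_trans Md.
  have -> : (1 - e) ^+ 4 * (d%:R / 2 * l) = (1 - e) ^+ 2 * M by rewrite /M /z1; ring.
  rewrite ler_piMl ?(ltW M0)// exprn_ile1 ?(ltW oe)//; lra.
by move: g4; rewrite expr1 expRN ler_pdivrMr ?expR_gt0// mul1r mulrC ler_pdivrMr// mulrC.
Qed.

End Main.

(** * The lower bound for fixed [e] and the limit *)

Section Lower.
Variable R : realType.

Lemma leq_sum5 (a b c d e m : nat) : (a + b + c + d + e + 2 <= m)%N ->
  [/\ (a <= m)%N, (b <= m)%N, (c <= m)%N & [/\ (d <= m)%N, (e <= m)%N & (2 <= m)%N]].
Proof. by move=> h; split; [lia|lia|lia|split; lia]. Qed.

Lemma bernoulli_le (x : R) n : 0 <= x <= 1 -> 1 - n%:R * x <= (1 - x) ^+ n.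
Proof.
move=> /andP[x0 x1]; elim: n => [|n IH]; first by rewrite mul0r subr0.
rewrite exprS; apply: le_trans (ler_wpM2l _ IH); last by rewrite subr_ge0.
rewrite -natr1 -subr_ge0.
have -> : (1 - x) * (1 - n%:R * x) - (1 - (n%:R + 1) * x) = n%:R * x ^+ 2 by ring.
by rewrite mulr_ge0 ?sqr_ge0.
Qed.

(** Four factors [1 - e] come from [code_of_system], one offsets the [1 + e] in the cap mass, and
    one offsets the square root of [d / (d - 1)]. *)
Lemma kissing_number_lower (e : R) : 0 < e < 1 -> exists N, forall d, (N <= d)%N ->
  (1 - e) ^+ 6 * kissing_asymp R d <= (kissing_number R d)%:R.
Proof.
move=> e01; case/andP: (e01) => e0 e1'.
pose l : R := ln (3 / 2); have l0 : 0 < l := ln32_gt0 R; have l2 : l <= 1 / 2 := ln32_le R.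
pose e1 := e * l / 4; pose dl := e1 / 2; pose C : R := 2 * expR 3.
have e10 : 0 < e1 by rewrite /e1 !mulr_gt0.
have el1 : e * l <= 1 by apply: mulr_ile1; lra.
have e1s : e1 <= 1 by rewrite /e1; lra.
have dl01 : 0 < dl < 1 by rewrite /dl; apply/andP; split; lra.
have [c [c01 hc]] := point_system e0 dl01.
have oe : 0 < 1 - e by rewrite subr_gt0.
have C0 : 0 < C by rewrite mulr_gt0 ?expR_gt0.
have e14 : 0 < e1 / 4 by rewrite divr_gt0.
pose k := (Num.truncn (`|ln c| / (e1 / 4))).+1.
have hk : - ln c <= k%:R * (e1 / 4).
  rewrite -ler_pdivrMr//.
  have q0 : 0 <= `|ln c| / (e1 / 4) by rewrite divr_ge0 ?(ltW e14).
  have /andP[_ /ltW h] := truncn_itv q0; apply: le_trans h.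
  by rewrite ler_pM2r ?invr_gt0// -normrN ler_norm.
have q1 : 0 <= 2 * C / e by rewrite divr_ge0 ?mulr_ge0 ?(ltW C0) ?(ltW e0).
have q2 : 0 <= 2 * C / e ^+ k.
  by rewrite divr_ge0 ?mulr_ge0 ?exprn_ge0 ?(ltW C0) ?(ltW e0).
have q3 : 0 <= 8 / ((1 - e) ^+ 2 * l).
  by rewrite divr_ge0 ?mulr_ge0 ?exprn_ge0 ?(ltW oe) ?(ltW l0).
have q4 : 0 <= e^-1 by rewrite invr_ge0 ltW.
have [N1 h1] := poly_exp_decay 2 q1 e14.
have [N2 h2] := poly_exp_decay k.+1 q2 e10.
have [N3 h3] := poly_exp_decay 1 q3 e10.
have c40 : 0 < 2 * (1 - e) * e1 by rewrite !mulr_gt0.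
have [N4 h4] := poly_exp_decay 1 q4 c40.
(* This threshold gives [e * d >= 1], whence [(1 - e) * Num.sqrt (d / (d - 1)) <= 1]. *)
pose N5 := (Num.truncn e^-1).+1.
exists (N1 + N2 + N3 + N4 + N5 + 2)%N => d /leq_sum5[m1 m2 m3 [m4 m5]].
case: d m1 m2 m3 m4 m5 => [|[|n]]// m1 m2 m3 m4 m5 _.
have [V [w [u [us hcap hexp hmass]]]] := hc n.
have hexp' x : dot n.+2 x x = 1 ->
    \sum_v w v * expR (Num.sqrt 2 * n.+2%:R * dot n.+2 (u v) x) <=
    C * n.+2%:R * (expR 1 / Num.sqrt 2) ^+ n.
  by have -> : C * n.+2%:R = 2 * n.+2%:R * expR 3; [rewrite /C; ring|exact: hexp].
have [I iI hI] := @code_of_system R e e1 dl c C k n e01 erefl erefl c01 erefl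
  (ltn0Sn _) hk (h1 _ m1) (h2 _ m2) (h3 _ m3) (h4 _ m4)
  V w u us hcap hexp' hmass.
have [w0 w1 u1] := us.
apply: (@le_trans _ _ #|I|%:R); last first.
  by rewrite ler_nat; apply: kissing_number_ge; exact: kissing_of_code.
have cb0 := cap_bound_gt0 R n.
have n1 : 0 < n.+1%:R :> R by rewrite ltr0n.
have n2 : 0 < n.+2%:R :> R by rewrite ltr0n.
rewrite kissing_asympE.
set A := n.+2%:R / 2 * l in hI *.
have A0 : 0 < A by rewrite !mulr_gt0 ?divr_gt0.
have hs : (1 - e) * Num.sqrt (n.+2%:R / n.+1%:R) <= 1.
  rewrite -(@ler_pXn2r _ 2)// ?nnegrE ?mulr_ge0 ?sqrtr_ge0 ?(ltW oe)//.
  rewrite exprMn sqr_sqrtr ?divr_ge0// expr1n mulrA ler_pdivrMr// mul1r.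
  have hn : 1 <= e * n.+2%:R.
    rewrite mulrC -ler_pdivrMr// div1r.
    have q0 : 0 <= e^-1 by rewrite invr_ge0 ltW.
    have /andP[_ /ltW h] := truncn_itv q0; apply: le_trans h _.
    by rewrite ler_nat.
  have -> : n.+1%:R = n.+2%:R - 1 :> R by rewrite -[n.+2%:R]natr1 addrK.
  have ez : 0 <= e * (1 - e) * n.+2%:R by rewrite !mulr_ge0 ?(ltW e0) ?(ltW oe) ?(ltW n2).
  by move: (n.+2%:R) hn ez => z; clear; lra.
have he : (1 - e) * (1 + e) <= 1 by have := sqr_ge0 e; clear; lra.
rewrite -(@ler_pM2r _ ((1 + e) * cap_bound R n)); last by rewrite mulr_gt0// addr_gt0.
apply: le_trans hI.
set Q := Num.sqrt _ in hs *.
have -> : (1 - e) ^+ 6 * (A / cap_bound R n * Q) * ((1 + e) * cap_bound R n) =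
    (1 - e) ^+ 4 * A * (((1 - e) * Q) * ((1 - e) * (1 + e))).
  by field; rewrite gt_eqF.
have Q0 : 0 <= Q by exact: sqrtr_ge0.
apply: ler_piMr; first by apply: mulr_ge0; [apply: exprn_ge0|]; exact: ltW.
apply: mulr_ile1 => //; first by apply: mulr_ge0 => //; exact: ltW.
by apply: mulr_ge0; [exact: ltW|apply: addr_ge0 => //; exact: ltW].
Qed.

End Lower.

Theorem theorem1 (R : realType) :
  exists eps : nat -> R,
    (eps @ \oo --> (0 : R)) /\
    \forall d \near \oo,
      (kissing_number R d)%:R >=
        (1 + eps d) *
        (Num.sqrt (3 * pi) / (4 * Num.sqrt 2) * ln (3 / 2)
         * d%:R `^ (3 / 2) * (2 / Num.sqrt 3) ^+ d).
Proof.
pose B := kissing_asymp R.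
have B_ge0 d : 0 <= B d.
  rewrite /B /kissing_asymp !mulr_ge0 ?exprn_ge0 ?divr_ge0 ?mulr_ge0 ?sqrtr_ge0 ?powR_ge0//.
  by rewrite ltW// ln32_gt0.
pose K d : R := (kissing_number R d)%:R.
(* The ratio is controlled only from below, so the cap at 0 is what makes the error converge. *)
exists (fun d => Num.min 0 (K d / B d - 1)); split; last first.
  near=> d; rewrite -/(kissing_asymp R d) -/(B d) -/(K d).
  (* Where [B d] vanishes the quotient carries no information, but the right-hand side is then
     zero. *)
  have [->|Bd] := eqVneq (B d) 0; first by rewrite mulr0 /K.
  have {}Bd : 0 < B d by rewrite lt0r Bd B_ge0.
  rewrite -ler_pdivlMr// -lerBrDl addrC ge_min; apply/orP; right.
  by rewrite addrC.
apply/cvgrPdist_le => /= e e0.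
(* Bernoulli's inequality turns [(1 - e1) ^+ 6] into at least [1 - 6 * e1], hence at least
   [1 - e]. *)
pose e1 := Num.min (e / 6) (1 / 2).
have e10 : 0 < e1 by rewrite lt_min !divr_gt0.
have e1e : e1 <= e / 6 by rewrite ge_min lexx.
have e12 : e1 <= 1 / 2 by rewrite ge_min lexx orbT.
have [N hN] := @kissing_number_lower R e1 (ltac:(by apply/andP; split; lra)).
exists (N + 1)%N => // d /= dN.
have hd := hN d (leq_trans (leq_addr _ _) dN).
have Bd : 0 < B d.
  have d0 : 0 < d%:R :> R by rewrite ltr0n (leq_trans _ dN)// addn1.
  have p0 : 0 < Num.sqrt (3 * pi) :> R by rewrite sqrtr_gt0 mulr_gt0// pi_gt0.
  have q0 : 0 < 2 / Num.sqrt 3 :> R by rewrite divr_gt0// sqrtr_gt0.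
  have r0 : 0 < 4 * Num.sqrt 2 :> R by rewrite mulr_gt0// sqrtr_gt0.
  apply: mulr_gt0; last exact: exprn_gt0.
  apply: mulr_gt0; last exact: powR_gt0.
  by apply: mulr_gt0; [exact: divr_gt0|exact: ln32_gt0].
have h6 : 1 - e <= K d / B d.
  rewrite ler_pdivlMr//; apply: le_trans hd; rewrite ler_wpM2r ?(ltW Bd)//.
  apply: le_trans (bernoulli_le 6 _); [lra|by apply/andP; split; lra].
rewrite sub0r normrN ler_norml le_min ge_min; apply/andP; split.
  by apply/andP; split; lra.
by apply/orP; left; exact: ltW.
Unshelve. all: by end_near. Qed.
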